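(* Let $0<p<2$, $\alpha>0$ and $\alpha p>1$. Let $(\Omega,\mathcal{H},\hat{\mathbb{E}})$ be a sub-linear expectation space with upper capacity $\mathbb{V}$ and conjugate expectation $\hat{\varepsilon}[\cdot]$, and let $\{X;X_n,n\geq1\}\subset\mathcal{H}$ be identically distributed random variables (each $X_n$ identically distributed with $X$), with $\{X_n,n\geq1\}$ extended negatively dependent (END). Assume further that, if $p>1$, $\hat{\mathbb{E}}[X]=0$ and $\hat{\mathbb{E}}[|X|^p]<\infty$. Let $l(x)$ be a slowly varying function and let $\{a_{ni},1\leq i\leq n,n\geq1\}$ be an array of nonnegative real numbers satisfying $\sum_{i=1}^{n}a_{ni}^{q}=O(n)$ for some $q>p$. If $C_{\mathbb{V}}\left[|X|^{p}l(|X|^{1/\alpha})\right]<\infty$, then for any real number $\varepsilon>0$, $$\sum_{n=1}^{\infty}n^{\alpha p-2}l(n)\,\mathbb{V}\left(\sum_{i=1}^{n}a_{ni}X_i>\varepsilon n^{\alpha}\right)<\infty.$$ If it is further assumed that $\hat{\varepsilon}[X]=0$ when $p>1$, then for any $\varepsilon>0$, $$\sum_{n=1}^{\infty}n^{\alpha p-2}l(n)\,\mathbb{V}\left(\left|\sum_{i=1}^{n}a_{ni}X_i\right|>\varepsilon n^{\alpha}\right)<\infty.$$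
   Context: Setting. $(\Omega,\mathcal{F})$ is a measurable space and $\mathcal{H}$ is a linear space of real functions on $(\Omega,\mathcal{F})$ (called random variables) such that $X_1,\dots,X_n\in\mathcal{H}$ implies $\varphi(X_1,\dots,X_n)\in\mathcal{H}$ for each $\varphi\in C_{l,Lip}(\mathbb{R}^n)$, where $C_{l,Lip}(\mathbb{R}^n)$ is the space of functions $\varphi$ with $|\varphi(x)-\varphi(y)|\leq C(1+|x|^m+|y|^m)|x-y|$ for all $x,y\in\mathbb{R}^n$, for some $C>0$, $m\in\mathbb{N}$ depending on $\varphi$. $C_{b,Lip}(\mathbb{R}^n)$ is the space of functions with $|\varphi(x)|\leq C$ and $|\varphi(x)-\varphi(y)|\leq C|x-y|$ for all $x,y$, for some $C>0$ depending on $\varphi$. Sub-linear expectation. $\hat{\mathbb{E}}:\mathcal{H}\to[-\infty,+\infty]$ satisfies, for all $X,Y\in\mathcal{H}$: (a) $X\geq Y$ implies $\hat{\mathbb{E}}[X]\geq\hat{\mathbb{E}}[Y]$; (b) $\hat{\mathbb{E}}[c]=c$ for constants $c$; (c) $\hat{\mathbb{E}}[X+Y]\leq\hat{\mathbb{E}}[X]+\hat{\mathbb{E}}[Y]$ whenever the right side is not of the form $+\infty-\infty$ or $-\infty+\infty$; (d) $\hat{\mathbb{E}}[\lambda X]=\lambda\hat{\mathbb{E}}[X]$ for $\lambda>0$. The triple $(\Omega,\mathcal{H},\hat{\mathbb{E}})$ is a sub-linear expectation space. The conjugate expectation is $\hat{\varepsilon}[X]:=-\hat{\mathbb{E}}[-X]$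 (not to be confused with the real number $\varepsilon$). Identical distribution. $X,Y\in\mathcal{H}$ are identically distributed if $\hat{\mathbb{E}}[\varphi(X)]=\hat{\mathbb{E}}[\varphi(Y)]$ for any $\varphi\in C_{l,Lip}(\mathbb{R})$, whenever the upper expectations are finite. Capacity and Choquet expectation. For $A\in\mathcal{F}$, $\mathbb{V}(A)=\inf\{\hat{\mathbb{E}}[\xi]: I_A\leq\xi,\ \xi\in\mathcal{H}\}$, where $I_A$ is the indicator function of $A$. The Choquet expectation is $C_{\mathbb{V}}[Y]=\int_0^\infty\mathbb{V}(Y\geq t)\,dt+\int_{-\infty}^{0}[\mathbb{V}(Y\geq t)-1]\,dt$. Extended negative dependence. A sequence $\{X_n,n\geq1\}\subset\mathcal{H}$ is upper (resp. lower) extended negatively dependent if there is a dominating constant $K\geq1$ such that $\hat{\mathbb{E}}\left[\prod_{i=1}^{n}f_i(X_i)\right]\leq K\prod_{i=1}^{n}\hat{\mathbb{E}}[f_i(X_i)]$ for all $n\geq1$, whenever the non-negative functions $f_i\in C_{b,Lip}(\mathbb{R})$, $i=1,2,\dots$, are all non-decreasing (resp. all non-increasing). The sequence is END if it is both upper and lower extended negatively dependent. Slow variation. A real valued function $l(x)$, positive and measurable on $\mathbb{R}^+$, is slowly varying if $\lim_{x\to\infty}l(\lambda x)/l(x)=1$ for each $\lambda>0$. Notation: $a_n=O(b_n)$ means there is a constant $C>0$ not depending on $n$ with $a_n\leq Cb_n$ for all $n\geq1$. *)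

(* Defs.v *)
From HB Require Import structures.
From mathcomp Require Import all_boot all_order all_algebra.
From mathcomp Require Import all_classical all_reals all_analysis.
Import Order.TTheory GRing.Theory Num.Theory.
Import numFieldNormedType.Exports.

Set Implicit Arguments.
Unset Strict Implicit.
Unset Printing Implicit Defensive.

Local Open Scope classical_set_scope.
Local Open Scope ring_scope.

Section lipschitz_classes.
Variable R : realType.

(* The norm that the library puts on 'rV[R]_n is the maximum norm. *)
Definition euclid n (x : 'rV[R]_n) : R := Num.sqrt (\sum_i x ord0 i ^+ 2).

(* C_{l,Lip}; [nrm] is [euclid] on R^n and [Num.norm] on R. *)
Definition C_lLip (V : zmodType) (nrm : V -> R) : set (V -> R) :=
  [set phi | exists (C : R) (m : nat), 0 < C /\
     forall x y : V, `|phi x - phi y| <=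
       C * (1 + nrm x ^+ m + nrm y ^+ m) * nrm (x - y)].

Definition C_bLip : set (R -> R) :=
  [set phi | exists C : R, 0 < C /\
     (forall x, `|phi x| <= C) /\
     (forall x y, `|phi x - phi y| <= C * `|x - y|)].

End lipschitz_classes.

(* [sexp] is a total function, constrained only on [rv]: its values outside
   [rv] are meaningless. *)
Record sublinear_space (R : realType) (d : measure_display)
    (Omega : measurableType d) := SublinearSpace {
  rv : set (Omega -> R) ;
  rv0 : rv (cst 0) ;
  rvD : forall X Y, rv X -> rv Y -> rv (fun w => X w + Y w) ;
  rvZ : forall (c : R) X, rv X -> rv (fun w => c * X w) ;
  rv_lLip : forall n (phi : 'rV[R]_n -> R) (X : 'I_n -> Omega -> R),
    C_lLip (@euclid R n) phi -> (forall i, rv (X i)) ->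
    rv (fun w => phi (\row_i X i w)) ;
  sexp : (Omega -> R) -> \bar R ;
  sexp_le : forall X Y, rv X -> rv Y -> (forall w, Y w <= X w) ->
    (sexp Y <= sexp X)%E ;
  sexp_cst : forall c : R, sexp (cst c) = c%:E ;
  sexpD : forall X Y, rv X -> rv Y -> (sexp X +? sexp Y)%E ->
    (sexp (fun w => (X w + Y w)%R) <= sexp X + sexp Y)%E ;
  sexpZ : forall (c : R) X, rv X -> 0 < c ->
    sexp (fun w => c * X w) = (c%:E * sexp X)%E }.

Section sublinear_expectation.
Context {R : realType} {d : measure_display} {Omega : measurableType d}.
Variable E : sublinear_space R Omega.

Definition conj_sexp (X : Omega -> R) : \bar R := (- sexp E (fun w => (- X w)%R))%E.

Definition identically_distributed (X Y : Omega -> R) : Prop :=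
  forall phi : R -> R, C_lLip Num.norm phi ->
    sexp E (phi \o X) \is a fin_num -> sexp E (phi \o Y) \is a fin_num ->
    sexp E (phi \o X) = sexp E (phi \o Y).

(* The formula makes sense for every subset A, so the events below need not be
   shown to be measurable; elements of [rv] are arbitrary real functions. *)
Definition capacity (A : set Omega) : \bar R :=
  ereal_inf [set sexp E xi | xi in
    [set xi | rv E xi /\ forall w, (\1_A w : R) <= xi w]].

Definition choquet (Y : Omega -> R) : \bar R :=
  (\int[lebesgue_measure]_(t in `[(0 : R)%R, +oo[) capacity [set w | (t <= Y w)%R]
   + \int[lebesgue_measure]_(t in `]-oo, (0 : R)%R])
       (capacity [set w | (t <= Y w)%R] - 1))%E.

(* Sequences are indexed from 1: the term X 0 is never used. *)
Definition END_for (monotone : (R -> R) -> Prop) (X : nat -> Omega -> R) :=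
  exists K : R, 1 <= K /\
    forall f : nat -> R -> R,
      (forall i, (1 <= i)%N ->
         [/\ C_bLip (f i), (forall x, 0 <= f i x) & monotone (f i)]) ->
      forall n, (1 <= n)%N ->
        (sexp E (fun w => (\prod_(1 <= i < n.+1) f i (X i w))%R)
         <= K%:E * \prod_(1 <= i < n.+1) sexp E (f i \o X i))%E.

Definition upper_END := END_for (fun f => {homo f : x y / x <= y}).

Definition lower_END := END_for (fun f => {homo f : x y / x <= y >-> y <= x}).

Definition END X := upper_END X /\ lower_END X.

End sublinear_expectation.

Definition slowly_varying (R : realType) (l : R -> R) : Prop :=
  [/\ forall x, 0 < x -> 0 < l x,
      measurable_fun (`]0, +oo[ : set R) l &
      forall lambda : R, 0 < lambda -> l (lambda * x) / l x @[x --> +oo] --> (1 : R)].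

(* Main.v *)
(** Truncate at [b = delta n^alpha].  If no weighted variable [a_i X_i] exceeds
    [b], Markov's inequality for [exp (T/b . sum)] together with upper extended
    negative dependence reduces everything to the exponential moments
    [1 + D e^(3T) (a_i/b)^s] with [alpha s > 1]; taking [T] a small multiple of
    [ln n] and [delta] small makes this contribution [O(n^(-B))] for a prescribed
    [B].  Here [s = p] when [p > 1] (second-order expansion of [exp] and
    [E[X] = 0]), and [s < p] when [p <= 1] (the Choquet condition gives a power
    bound on the tail).

    The event that some [a_i X_i] exceeds [b] is handled dyadically.  With
    [tau_k = V(|X| >= 2^(k alpha))] and [t_k = 2^(k alpha p) l(2^k)], the Choquet
    condition says [sum t_k tau_k < oo], and the weights spread each [tau_k] over
    the later blocks with the factor [2^(- alpha q)] per block.  Since [p < q] this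
    beats the growth rate of [t_k], which is close to [2^(alpha p)].  The second
    claim is the first one applied to [X] and to [-X]. *)
Require Import Defs.
From HB Require Import structures.
From mathcomp Require Import all_boot all_order all_algebra.
From mathcomp Require Import all_classical all_reals all_analysis.
From mathcomp Require Import measurable_realfun ring lra.
Import Order.TTheory GRing.Theory Num.Theory.
Import numFieldNormedType.Exports.

Set Implicit Arguments.
Unset Strict Implicit.

Local Open Scope classical_set_scope.
Local Open Scope ring_scope.

(** * Slowly varying functions *)

(** The pushforward of Lebesgue measure under a translation gives half-open intervals their length,
    so uniqueness of the measure identifies the two. *)
Lemma lebesgue_measure_translate (R : realType) (v : R) (A : set R) :
  measurable A ->
  lebesgue_measure ((fun x : R => x + v) @^-1` A) = lebesgue_measure A.
Proof.
move=> mA.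
have mf : measurable_fun [set: measurableTypeR R]
    ((fun x : R => x + v) : measurableTypeR R -> measurableTypeR R).
  exact: measurable_funD.
pose f : {mfun measurableTypeR R >-> measurableTypeR R} :=
  HB.pack (fun x : R => x + v) (isMeasurableFun.Build _ _ _ _ _ mf).
rewrite [RHS](@lebesgue_measure_unique R (pushforward lebesgue_measure f))//.
move=> _ [[a b] _ <-]; rewrite /pushforward /=.
transitivity (lebesgue_measure (`]a - v, b - v]%classic : set R)); last first.
  congr (lebesgue_measure _).
  apply/seteqP; split=> x /=; rewrite !in_itv/= => /andP[h1 h2]; apply/andP; split; lra.
rewrite !lebesgue_measure_itv /= !lte_fin ltrD2r.
by case: ifPn => // _; rewrite -!EFinD; congr EFin; lra.
Qed.

(** Both [U] and the translate of [V] by [v] lie in [0, 3]. If they were disjoint, their union would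
    have measure greater than 3. *)
Lemma large_translates_meet (R : realType) (v : R) (U V : set R) :
  measurable U -> measurable V -> U `<=` `[0, 2] -> V `<=` `[0, 2] ->
  0 <= v <= 1 ->
  ((3/2)%:E < lebesgue_measure U)%E -> ((3/2)%:E < lebesgue_measure V)%E ->
  exists u, U u /\ V (u - v).
Proof.
move=> mU mV U02 V02 /andP[v0 v1] hU hV; apply: contrapT => nex.
pose W := (fun x : R => x + - v) @^-1` V.
have mW : measurable W.
  rewrite -[W]setTI; apply: (measurable_funD (@measurable_id _ _ _)
    (@measurable_cst _ _ _ _ _ _)) => //.
have hW : ((3/2)%:E < lebesgue_measure W)%E by rewrite lebesgue_measure_translate.
have UW0 : U `&` W = set0.
  by rewrite -subset0 => x [Ux Wx]; apply: nex; exists x.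
have UW3 : U `|` W `<=` `[0, 3]%classic.
  move=> x [/U02|/V02] /=; rewrite !in_itv/= => /andP[h1 h2]; apply/andP; split; lra.
have L3 : lebesgue_measure (`[0, 3]%classic : set R) = 3%:E.
  by rewrite lebesgue_measure_itv /= lte_fin ltr0n /= oppr0 adde0.
have : (lebesgue_measure (U `|` W) <= 3%:E)%E.
  rewrite -L3; apply: le_measure => //; rewrite inE; last exact: measurable_itv.
  exact: measurableU.
rewrite measureU//.
apply/negP; rewrite -ltNge.
by rewrite (_ : 3%:E = (3/2)%:E + (3/2)%:E :> \bar R)%E ?lteD// -EFinD; congr EFin; lra.
Qed.

(* The classical proof of the uniform convergence theorem, by Egorov-type sets
   indexed by a hypothetical sequence of counterexamples. *)
Lemma additive_slow_variation_bounded (R : realType) (h : R -> R) :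
  measurable_fun setT h ->
  (forall v, h (u + v) - h u @[u --> +oo] --> 0) ->
  exists N : R, forall x v, N <= x -> 0 <= v <= 1 -> `|h (x + v) - h x| <= 2.
Proof.
move=> mh hcv; apply: contrapT => nex.
have /choice[xv Hxv] : forall n : nat, exists z : R * R,
    [/\ n%:R <= z.1, 0 <= z.2 <= 1 & 2 < `|h (z.1 + z.2) - h z.1|].
  move=> n; apply: contrapT => nn; apply: nex; exists n%:R => x v nx v01.
  by rewrite leNgt; apply/negP => hh; apply: nn; exists (x, v).
(* [U n] collects the shifts in [0, 2] whose increments at every [y m] with [m >= n] are at most 1.
   By pointwise convergence these sets increase to [0, 2], so their measures tend to 2 and
   eventually exceed 3/2. *)
have key (y : nat -> R) : (forall n, n%:R <= y n) ->
    let U n := [set u : R | 0 <= u <= 2] `&`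
       \bigcap_(m in [set m | (n <= m)%N]) [set u | `|h (y m + u) - h (y m)| <= 1] in
    (forall n, measurable (U n)) /\
    \forall n \near \oo, ((3/2)%:E < lebesgue_measure (U n))%E.
  move=> yn U.
  have mU n : measurable (U n).
    apply: measurableI.
      rewrite (_ : [set _ | _] = `[0, 2]%classic); first exact: measurable_itv.
      by apply/seteqP; split => x; rewrite /= in_itv.
    apply: bigcap_measurable => [|m _]; first by exists n => /=.
    have mg : measurable_fun setT (fun u => `|h (y m + u) - h (y m)|).
      apply: measurableT_comp => //; apply: measurable_funB => //.
      by apply: measurableT_comp => //; apply: measurable_funD.
    rewrite (_ : [set _ | _] = (fun u => `|h (y m + u) - h (y m)|) @^-1` `]-oo, 1]).
      rewrite -[X in measurable X]setTI; apply: mg => //.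
    by apply/seteqP; split => x; rewrite /= in_itv.
  split=> //.
  have UE : \bigcup_n U n = `[0, 2]%classic.
    apply/seteqP; split => [x [n _ []]|x]; rewrite /= in_itv //= => x02.
    have : \forall u \near +oo, `|h (u + x) - h u| <= 1.
      have /cvgrPdist_le/(_ 1 ltr01) := hcv x.
      by apply: filterS => u; rewrite sub0r normrN.
    move=> [A [_ HA]].
    have [n An] : exists n : nat, A < n%:R.
      by exists (Num.truncn `|A|).+1; rewrite (le_lt_trans (ler_norm A))// truncnS_gt.
    exists n => //; split => // m /= nm; apply: HA.
    by apply: lt_le_trans An _; apply: le_trans (yn m); rewrite ler_nat.
  have : lebesgue_measure (U n) @[n --> \oo] --> (2%:E : \bar R).
    have -> : 2%:E = lebesgue_measure (\bigcup_n U n) :> \bar R.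
      by rewrite UE lebesgue_measure_itv /= lte_fin ltr0n oppr0 adde0.
    apply: nondecreasing_cvg_mu => //; first by rewrite UE; exact: measurable_itv.
    move=> n m nm; apply/subsetPset => u [u02 Hu]; split => // k /= mk.
    by apply: Hu => /=; apply: leq_trans mk.
  move=> cv.
  have : \forall z \near (2%:E : \bar R), ((3/2)%:E < z)%E.
    by apply: open_ereal_gt'; rewrite lte_fin; lra.
  exact: cv.
have [mU NU] := key (fun n => (xv n).1) (fun n => let: And3 a _ _ := Hxv n in a).
have [|mV NV] := key (fun n => (xv n).1 + (xv n).2).
  move=> n; have [a /andP[b _] _] := Hxv n; lra.
near \oo => n.
have [a b c] := Hxv n.
(* The common point gives two increments of size at most 1, from x_n and from x_n + v_n, ending at
   the same place x_n + u. Their difference is the increment assumed to exceed 2. *)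
have [||||u [[_ /(_ n (leqnn _)) /= h1] [_ /(_ n (leqnn _)) /= h2]]] :=
    @large_translates_meet R (xv n).2 _ _ (mU n) (mV n) _ _ b.
- by move=> x [] /=; rewrite in_itv.
- by move=> x [] /=; rewrite in_itv.
- by near: n.
- by near: n.
have e : (xv n).1 + (xv n).2 + (u - (xv n).2) = (xv n).1 + u by ring.
rewrite e in h2.
move: h1 h2 c; set A := h _; set B := h _; set C := h _.
rewrite ltNge => h1 h2 /negP; apply.
rewrite (_ : C - B = (A - B) - (A - C)); last ring.
by rewrite (le_trans (ler_normB _ _))// (_ : 2 = 1 + 1) ?lerD.
Unshelve. all: by end_near. Qed.

(** The substitution h = ln o l o exp makes slow variation additive. The increment bound 2 becomes
    the factor [M = expR 2], and [lam] in [1, 2] has its logarithm in [0, 1]. *)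
Lemma slowly_varying_bounded (R : realType) (l : R -> R) :
  slowly_varying l -> exists M x0 : R, [/\ 1 <= M, 1 <= x0 &
    forall x lam, x0 <= x -> 1 <= lam <= 2 ->
      M^-1 * l x <= l (lam * x) <= M * l x].
Proof.
move=> [l0 ml lv].
pose h (u : R) := ln (l (expR u)).
have mh : measurable_fun setT h.
  apply: measurableT_comp => //.
  apply: (@measurable_comp _ _ _ _ _ _ (`]0, +oo[ : set R)%classic) => //.
  by move=> _ [u _ <-]; rewrite /= in_itv/= expR_gt0.
have hcv v : h (u + v) - h u @[u --> +oo] --> 0.
  have := lv (expR v) (expR_gt0 v).
  move=> cv.
  have -> : (fun u => h (u + v) - h u) =
      (fun x => ln (l (expR v * x) / l x)) \o expR.
    apply/funext => u /=; rewrite /h [u + v]addrC expRD.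
    have p1 : 0 < l (expR u) by rewrite l0// expR_gt0.
    have p2 : 0 < l (expR v * expR u) by rewrite l0// mulr_gt0 ?expR_gt0.
    by rewrite ln_div.
  suff : (fun x => ln (l (expR v * x) / l x)) \o expR @ +oo --> ln (1 : R).
    by rewrite ln1.
  apply: (@cvg_comp _ _ _ expR (fun x => ln (l (expR v * x) / l x)) _ (pinfty_nbhs R)).
    apply: (@ger_cvgy _ _ _ R id expR); last exact: cvg_id.
    by near=> u; rewrite /= (le_trans _ (expR_ge1Dx _))// lerDr.
  by apply: (@continuous_cvg _ _ _ (pinfty_nbhs R)) cv; exact: continuous_ln.
have [N HN] := additive_slow_variation_bounded mh hcv.
exists (expR 2), (expR (Num.max N 0)); split.
- by rewrite -expR0 ler_expR.
- by rewrite -expR0 ler_expR le_max lexx orbT.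
move=> x lam x0x /andP[l1 l2].
have xp : 0 < x by rewrite (lt_le_trans _ x0x)// expR_gt0.
have lp : 0 < lam by lra.
have Nx : N <= ln x.
  rewrite -ler_expR lnK ?posrE// (le_trans _ x0x)// ler_expR le_max lexx//.
have L01 : 0 <= ln lam <= 1.
  rewrite ln_ge0//= -ler_expR lnK ?posrE// (le_trans l2)//.
  by rewrite (le_trans _ (expR_ge1Dx _))//; lra.
have := HN _ _ Nx L01.
rewrite /h expRD !lnK ?posrE// [x * _]mulrC.
rewrite ler_norml => /andP[h1 h2].
rewrite -expRN -[l (lam * x)]lnK ?posrE ?l0 ?mulr_gt0//.
rewrite -[l x]lnK ?posrE ?l0// -!expRD !ler_expR; apply/andP; split; lra.
Unshelve. all: by end_near. Qed.

Lemma slowly_varying_dyadic (R : realType) (l : R -> R) (u a b : R) :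
  slowly_varying l -> 0 < u -> a < u < b ->
  exists k0 : nat, forall k, (k0 <= k)%N ->
    a * (u ^+ k * l (2 ^+ k)) <= u ^+ k.+1 * l (2 ^+ k.+1)
      <= b * (u ^+ k * l (2 ^+ k)).
Proof.
move=> [l0 _ lv] u0 /andP[au ub].
have := lv 2 (ltr0Sn _ _).
(* Within this tolerance of 1, the ratio l(2^(k+1)) / l(2^k) stays between a/u and b/u. *)
have e0 : 0 < Num.min (1 - a / u) (b / u - 1).
  by rewrite lt_min !subr_gt0 ltr_pdivrMr// mul1r au ltr_pdivlMr// mul1r ub.
move=> /cvgrPdist_le/(_ _ e0)[A [_ HA]].
exists (Num.truncn `|A|).+1 => k Ak.
have pk : A < 2 ^+ k.
  rewrite (le_lt_trans (ler_norm A))// (lt_le_trans (truncnS_gt _))//.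
  by rewrite -natrX ler_nat (leq_trans Ak)// ltnW// ltn_expl.
have := HA _ pk; rewrite -exprS.
have := l0 (2 ^+ k) (exprn_gt0 _ (ltr0Sn _ _)).
set L := l (2 ^+ k); set L' := l (2 ^+ k.+1) => L0.
rewrite le_min !ler_norml => /andP[/andP[_ h1] /andP[h2 _]].
have {}h1 : a / u <= L' / L by lra.
have {}h2 : L' / L <= b / u by lra.
move: h1 h2; rewrite ler_pdivlMr// ler_pdivrMr// ![_ / u * _]mulrAC.
rewrite ler_pdivrMr// ler_pdivlMr// [L' * u]mulrC => h1 h2.
have uk : 0 < u ^+ k by rewrite exprn_gt0.
by rewrite exprS !mulrA ![_ * u ^+ k]mulrC -!mulrA !ler_pM2l// h1.
Qed.

(** * Real inequalities and dyadic sums *)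

(** [S] is the convolution of [tau] with the powers of [r]. One step of the recursion multiplies the
    carried part by [r] and its weight by at most [rho], so the bound is effective when
    [rho * r < 1]. *)
Lemma convolution_weighted_sum (R : realType) (t tau S : nat -> R) (rho r : R) :
  (forall j, 0 <= S j) -> 0 <= rho -> 0 <= r -> (forall j, 0 <= t j) ->
  S 0%N = tau 0%N -> (forall j, S j.+1 = r * S j + tau j.+1) ->
  (forall j, t j.+1 <= rho * t j) ->
  forall N, (1 - rho * r) * \sum_(j < N) t j * S j <= \sum_(j < N) t j * tau j.
Proof.
move=> S0 rho0 r0 t0 S0E SS tS [|N]; first by rewrite !big_ord0 mulr0.
(* The boundary term is what pays for the carried part [t N.+1 * (r * S N)] in the next step of the
   induction. *)
suff H : (1 - rho * r) * \sum_(j < N.+1) t j * S j + rho * r * (t N * S N)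
    <= \sum_(j < N.+1) t j * tau j.
  by rewrite (le_trans _ H)// lerDl !mulr_ge0.
elim: N => [|N IH].
  by rewrite !big_ord_recr !big_ord0 /= !add0r S0E -mulrDl subrK mul1r.
rewrite big_ord_recr [leRHS]big_ord_recr /=.
have h : t N.+1 * (r * S N) <= rho * t N * (r * S N).
  by rewrite ler_wpM2r ?mulr_ge0.
rewrite SS; nra.
Qed.

(** For [A <= 1], monotonicity gives [G m A <= G m 1 <= S m]. A larger [A] is divided by [lam]
    repeatedly, lowering the level each time, and [A <= lam ^+ m] ensures that 1 is reached before
    the levels run out. *)
Lemma scaled_tail_bound (R : realType) (G : nat -> R -> R) (S : nat -> R)
    (lam q : R) : 1 < lam -> 0 < q -> (forall m A, 0 <= G m A) ->
  (forall m A B, 0 <= A -> A <= B -> G m A <= G m B) ->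
  (forall m A, G m.+1 A = G m (A / lam)) ->
  S 0%N = G 0%N 1 -> (forall m, S m.+1 = (lam `^ q)^-1 * S m + G m.+1 1) ->
  forall m A, 0 <= A -> A <= lam ^+ m ->
    G m A <= (1 + lam `^ q * A `^ q) * S m.
Proof.
move=> lam1 q0 G0 Gh GS S0 SS m A A0 Am.
have lam0 : 0 < lam by lra.
have lq0 : 0 < lam `^ q by rewrite powR_gt0.
have S_ge0 k : 0 <= S k.
  by elim: k => [|k IH]; rewrite ?S0 ?SS ?addr_ge0 ?mulr_ge0 ?invr_ge0// ltW.
have small k B : 0 <= B -> B <= 1 -> G k B <= S k.
  move=> B0 B1; apply: le_trans (Gh k B 1 B0 B1) _.
  by case: k => [|k]; rewrite ?S0 ?SS ?lerDr ?mulr_ge0 ?invr_ge0// ltW.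
(* Going down one level divides B^q by lam^q, while [S k] is at most lam^q times [S k.+1]. The two
   factors cancel, so the constant does not grow along the induction. *)
have large k : forall B, 1 < B -> B <= lam ^+ k -> G k B <= lam `^ q * B `^ q * S k.
  elim: k => [|k IH] B B1 Bk; first by move: B1; rewrite ltNge -[1]/(lam ^+ 0) Bk.
  have B0 : 0 <= B by lra.
  have Sk : S k <= lam `^ q * S k.+1.
    by rewrite SS mulrDr mulrA divff ?gt_eqF// mul1r lerDl mulr_ge0// ltW.
  have Bq1 : 1 <= B `^ q.
    by have := @ge0_ler_powR _ q (ltW q0) 1 B; rewrite powR1 !nnegrE; apply=> //; lra.
  rewrite GS; case: (leP (B / lam) 1) => hB.
    apply: le_trans (small _ _ (divr_ge0 B0 (ltW lam0)) hB) _.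
    rewrite (le_trans Sk)// -mulrA [B `^ q * _]mulrC mulrA ler_peMr//.
    by rewrite mulr_ge0// ltW.
  have /IH := hB; rewrite ler_pdivrMr// -exprSr => /(_ Bk) h.
  apply: le_trans h _.
  have lqV : lam^-1 `^ q = (lam `^ q)^-1.
    by rewrite -powR_inv1 ?(ltW lam0)// powRAC powR_inv1 ?powR_ge0.
  rewrite powRM// ?invr_ge0 ?(ltW lam0)// lqV mulrCA divff ?gt_eqF// mulr1.
  by rewrite [X in _ <= X * _]mulrC -mulrA ler_wpM2l ?powR_ge0.
case: (leP A 1) => hA.
  by rewrite (le_trans (small _ _ A0 hA))// ler_peMl// lerDl mulr_ge0 ?powR_ge0.
by rewrite (le_trans (large _ _ hA Am))// ler_wpM2r// lerDr.
Qed.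

(** The block from 2^m to 2^(m+1) has 2^m terms, so it contributes at most [d m]. The indices below
    2^m1 form a finite sum. *)
Lemma dyadic_blocks_summable (R : realType) (f d : nat -> R) (m1 : nat) (D : R) :
  (forall n, (1 <= n)%N -> 0 <= f n) ->
  (forall m n, (m1 <= m)%N -> (2 ^ m <= n < 2 ^ m.+1)%N -> f n <= d m / 2 ^+ m) ->
  (forall N, \sum_(m1 <= m < N) d m <= D) ->
  (\sum_(1 <= n <oo) (f n)%:E < +oo)%E.
Proof.
move=> f0 fd dD.
pose C := \sum_(1 <= n < (2 ^ m1)%N) f n.
have step N : (m1 <= N)%N -> \sum_(1 <= n < (2 ^ N)%N) f n <= C + \sum_(m1 <= m < N) d m.
  have base : \sum_(1 <= n < (2 ^ m1)%N) f n <= C + \sum_(m1 <= m < m1) d m.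
    by rewrite (@big_geq _ _ _ m1 m1)// addr0.
  elim: N => [|N IH]; first by rewrite leqn0 => /eqP m10; move: base; rewrite m10.
  rewrite leq_eqVlt => /predU1P[<-//|].
  rewrite ltnS => mN; rewrite (@big_cat_nat _ _ _ (2 ^ N)%N) ?expn_gt0// ?leq_exp2l//=.
  rewrite [X in _ <= _ + X]big_nat_recr//= addrA lerD ?IH//.
  have : \sum_(2 ^ N <= n < 2 ^ N.+1) f n <= \sum_(2 ^ N <= n < 2 ^ N.+1) d N / 2 ^+ N.
    by rewrite !big_nat; apply: ler_sum => n hn; exact: fd.
  move=> /le_trans; apply; rewrite sumr_const_nat expnS mul2n -addnn addnK.
  by rewrite -[_ *+ (2 ^ N)%N]mulr_natr natrX divfK// expf_neq0.
apply: (@le_lt_trans _ _ (C + D)%:E); last by rewrite ltry.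
apply: lime_le.
  by apply: is_cvg_nneseries => n n1 _; rewrite lee_fin f0.
near=> N.
have N2 : (N <= 2 ^ (maxn m1 N))%N.
  by rewrite (leq_trans (leq_maxr m1 N))// ltnW// ltn_expl.
rewrite sumEFin lee_fin.
apply: le_trans (_ : \sum_(1 <= n < (2 ^ (maxn m1 N))%N) f n <= _).
  case: (posnP N) => [->|N0].
    by rewrite big_geq// big_nat sumr_ge0// => n /andP[/f0].
  rewrite [leRHS](@big_cat_nat _ _ _ N)//= lerDl big_nat sumr_ge0// => n /andP[Nn _].
  by rewrite f0// (leq_trans N0).
by rewrite (le_trans (step _ (leq_maxl _ _)))// lerD2l.
Unshelve. all: by end_near. Qed.

(** Three ranges. On [-1, 1/2], exp v <= 1/(1 - v) <= 1 + v + 2 v^2 and v^2 <= |v|^s. Below -1, exp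
    v <= 1 and -v <= |v|^s. Above 1/2, |v|^s >= 1/4, so the last term alone dominates exp v. *)
Lemma expR_le_second_order (R : realType) (v v0 s : R) : v <= v0 -> 0 <= v0 ->
  1 <= s -> s <= 2 -> expR v <= 1 + v + 4 * (expR v0 * `|v| `^ s).
Proof.
move=> vv0 v00 s1 s2.
have e0 : 1 <= expR v0 by rewrite -expR0 ler_expR.
have big : 1 <= `|v| -> `|v| <= `|v| `^ s by move=> h; exact: le1r_powR.
have sq : `|v| <= 1 -> v ^+ 2 <= `|v| `^ s.
  move=> h; have [->|v_neq0] := eqVneq v 0; first by rewrite expr0n powR_ge0.
  rewrite -[v ^+ 2]ger0_norm ?sqr_ge0// normrX -powR_mulrn//; apply: ger_powR => //.
  by rewrite normr_gt0 v_neq0.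
have pw : 0 <= `|v| `^ s by rewrite powR_ge0.
set w := `|v| `^ s in big sq pw *.
have [v_small|v_large] := leP v (1/2).
  have hw : w <= expR v0 * w by rewrite ler_peMl.
  have [v1|v1] := leP (-1) v.
    have := sq; rewrite ler_norml => hsq.
    have {hsq} := hsq _; rewrite v1 => hsq.
    have {}hsq : v ^+ 2 <= w by apply: hsq; lra.
    have h : expR v * (1 - v) <= 1.
      rewrite -[leRHS](@expRxMexpNx_1 R v) ler_pM2l ?expR_gt0//.
      by have := expR_ge1Dx (- v); lra.
    have h2 : expR v <= 1 + v + 2 * v ^+ 2.
      have : expR v <= (1 - v)^-1 by rewrite -[leRHS]mul1r ler_pdivlMr//; lra.
      move/le_trans; apply; rewrite -[leLHS]mul1r ler_pdivrMr; last lra.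
      nra.
    by lra.
  have h1 : expR v <= 1 by rewrite -expR0 ler_expR; lra.
  have := big; rewrite ltr0_norm; last lra.
  move=> /(_ _) h2; have {}h2 : - v <= w by apply: h2; lra.
  by lra.
have ev : expR v <= expR v0 by rewrite ler_expR.
have hw : 1/4 <= w.
  have [v1|v1] := leP `|v| 1; first by have := sq v1; nra.
  by have := big (ltW v1); lra.
by nra.
Qed.

(** Since y/x lies in [0, 1], (y/x)^s >= (y/x)^2; hence the difference is at most x^s (1 - (y/x)^2),
    and x^s <= x (1 + x). This puts |x|^s in [C_lLip]. *)
Lemma powR_dist_le (R : realType) (s x y : R) : 1 <= s -> s <= 2 -> 0 <= y -> y <= x ->
  `|x `^ s - y `^ s| <= 2 * (1 + x + y) * (x - y).
Proof.
move=> s1 s2 y0 yx.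
have [x0|x0] := ltP 0 x; last first.
  have -> : x = 0 by lra.
  have -> : y = 0 by lra.
  by rewrite !subrr normr0 mulr0.
have h : y `^ s <= x `^ s by rewrite ge0_ler_powR ?nnegrE//; lra.
rewrite ger0_norm ?subr_ge0//.
have zs : (y / x) ^+ 2 <= (y / x) `^ s.
  have [->|y_neq0] := eqVneq y 0; first by rewrite mul0r expr0n powR_ge0.
  rewrite -powR_mulrn; last by rewrite divr_ge0// ltW.
  apply: ger_powR => //.
  have y_gt0 : 0 < y by rewrite lt_def y_neq0.
  by rewrite divr_gt0//= ler_pdivrMr// mul1r.
have yE : y `^ s = x `^ s * (y / x) `^ s.
  by rewrite -powRM ?divr_ge0 ?(ltW x0)// mulrCA divff ?gt_eqF// mulr1.
have xs : x `^ s <= x * (1 + x).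
  have [x1|x1] := leP x 1.
    rewrite (@le_trans _ _ x)//; last by nra.
    by apply: ge1r_powR => //; rewrite x0.
  rewrite (@le_trans _ _ (x ^+ 2))//; last by nra.
  by rewrite -powR_mulrn ?(ltW x0)//; apply: ler_powR => //; exact: ltW.
have h2 : x `^ s - y `^ s <= x `^ s * (1 - (y / x) ^+ 2).
  by rewrite yE mulrBr mulr1 lerD2l lerN2 ler_wpM2l ?powR_ge0.
have x_neq0 : x != 0 by rewrite gt_eqF.
have h3 : 0 <= 1 - (y / x) ^+ 2.
  by rewrite subr_ge0 expr_le1 ?divr_ge0 ?(ltW x0)// ler_pdivrMr// mul1r.
apply: le_trans h2 _; apply: le_trans (ler_wpM2r h3 xs) _.
have -> : x * (1 + x) * (1 - (y / x) ^+ 2) = (1 + x) * (x + y) / x * (x - y) by field.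
rewrite ler_wpM2r ?subr_ge0//.
by rewrite ler_pdivrMr//; nra.
Qed.

(** * Sub-linear expectations and capacities *)

Section lipschitz_functions.
Context {R : realType}.
Implicit Types (x y u v c z T : R) (f : R -> R).

Lemma norm_min_sub c u v : `|Num.min u c - Num.min v c| <= `|u - v|.
Proof.
have := ler_norm (u - v); have := ler_norm (v - u); rewrite [`|v - u|]distrC.
move=> h1 h2; rewrite ler_norml.
by case: (leP u c); case: (leP v c) => h3 h4; apply/andP; split; lra.
Qed.

Lemma norm_max_sub c u v : `|Num.max c u - Num.max c v| <= `|u - v|.
Proof.
have := ler_norm (u - v); have := ler_norm (v - u); rewrite [`|v - u|]distrC.
move=> h1 h2; rewrite ler_norml.
by case: (leP c u); case: (leP c v) => h3 h4; apply/andP; split; lra.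
Qed.

Lemma norm_expR_sub u v T : u <= T -> v <= T ->
  `|expR u - expR v| <= expR T * `|u - v|.
Proof.
wlog vu : u v / v <= u => [H|] uT vT.
  have [/H|/ltW/H] := leP v u; first exact.
  by rewrite distrC [`|v - u|]distrC; exact.
rewrite !ger0_norm ?subr_ge0 ?ler_expR//.
apply: le_trans (_ : expR u * (u - v) <= _); last first.
  by rewrite ler_wpM2r ?subr_ge0// ler_expR.
have -> : expR u - expR v = expR u * (1 - expR (v - u)).
  by rewrite mulrBr mulr1 -expRD addrCA subrr addr0.
by rewrite ler_wpM2l ?expR_ge0//; have := expR_ge1Dx (v - u); lra.
Qed.

Lemma lipschitz_C_lLip (k : R) f : 0 < k ->
  (forall x y, `|f x - f y| <= k * `|x - y|) -> C_lLip Num.norm f.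
Proof.
move=> k0 fk; exists k, 0%N; split=> // x y.
rewrite !expr0; apply: le_trans (fk x y) _.
by rewrite ler_wpM2r// ler_peMr ?(ltW k0)//; lra.
Qed.

Lemma C_bLip_C_lLip f : C_bLip f -> C_lLip Num.norm f.
Proof. by move=> [C [C0 [_ H]]]; exact: lipschitz_C_lLip H. Qed.

Lemma C_lLip_opp f : C_lLip Num.norm f -> C_lLip Num.norm (fun x => f (- x)).
Proof.
move=> [C [m [C0 H]]]; exists C, m; split=> // x y.
by have := H (- x) (- y); rewrite !normrN -opprD normrN.
Qed.

Lemma C_bLip_opp f : C_bLip f -> C_bLip (fun x => f (- x)).
Proof.
move=> [C [C0 [H1 H2]]]; exists C; split=> //; split=> [x|x y]; first exact: H1.
by have := H2 (- x) (- y); rewrite -opprD normrN.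
Qed.

Lemma powR_norm_C_lLip (s : R) : 1 <= s -> s <= 2 ->
  C_lLip Num.norm (fun x : R => `|x| `^ s).
Proof.
move=> s1 s2; exists 2, 1%N; split=> // x y; rewrite !expr1.
wlog yx : x y / `|y| <= `|x| => [H|].
  have [/H//|/ltW/H] := leP `|y| `|x|.
  by rewrite distrC [`|y - x|]distrC [1 + _ + _]addrAC.
apply: le_trans (powR_dist_le s1 s2 (normr_ge0 y) yx) _.
rewrite ler_wpM2l ?mulr_ge0 ?addr_ge0//.
exact: le_trans (ler_norm _) (ler_dist_dist _ _).
Qed.

(* A Lipschitz function between the indicators of [1 <= z * x] and [1/2 <= z * x]. *)
Definition ramp z x : R := Num.min (Num.max 0 (2 * (z * x) - 1)) 1.

Lemma ramp_ge0 z x : 0 <= ramp z x.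
Proof. by rewrite /ramp le_min ler01 le_max lexx. Qed.

Lemma ramp_le1 z x : ramp z x <= 1.
Proof. by rewrite /ramp ge_min lexx orbT. Qed.

Lemma ramp_eq1 z x : 1 <= z * x -> ramp z x = 1.
Proof. by move=> h; rewrite /ramp min_r// le_max; apply/orP; right; lra. Qed.

Lemma ramp_eq0 z x : z * x <= 1/2 -> ramp z x = 0.
Proof. by move=> h; rewrite /ramp max_l ?min_l//; lra. Qed.

Lemma ramp_C_bLip z : C_bLip (ramp z).
Proof.
exists (1 + 2 * `|z|); split; first by rewrite ltr_wpDr ?mulr_ge0.
split=> [x|x y].
  by rewrite ger0_norm ?ramp_ge0// (le_trans (ramp_le1 _ _))// lerDl mulr_ge0.
apply: le_trans (norm_min_sub _ _ _) _; apply: le_trans (norm_max_sub _ _ _) _.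
rewrite (_ : _ - _ - (_ - _) = 2 * z * (x - y)); last by ring.
by rewrite !normrM ger0_norm// ler_wpM2r// lerDr.
Qed.

(** The cut at 1 makes the exponential bounded and Lipschitz for [T >= 0], hence admissible in the
    dependence inequality. *)
Definition exp_trunc T z x : R := expR (T * Num.min (z * x) 1).

Lemma exp_trunc_ge0 T z x : 0 <= exp_trunc T z x.
Proof. exact: expR_ge0. Qed.

Lemma exp_trunc_C_bLip T z : 0 <= T -> C_bLip (exp_trunc T z).
Proof.
move=> T0; exists (expR T * (1 + T * `|z|)).
have h1 : 1 <= 1 + T * `|z| by rewrite lerDl mulr_ge0.
have h x : T * Num.min (z * x) 1 <= T.
  by rewrite ler_piMr// ge_min lexx orbT.
split; first by rewrite mulr_gt0 ?expR_gt0 ?(lt_le_trans _ h1).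
split=> [x|x y].
  rewrite ger0_norm ?expR_ge0// (le_trans (_ : _ <= expR T)) ?ler_expR//.
  by rewrite ler_peMr ?expR_ge0.
apply: le_trans (norm_expR_sub (h x) (h y)) _.
rewrite -mulrA ler_wpM2l ?expR_ge0// -mulrBr normrM ger0_norm//.
apply: (@le_trans _ _ (T * `|z * x - z * y|)).
  by rewrite ler_wpM2l// norm_min_sub.
by rewrite -mulrBr normrM mulrA ler_wpM2r// lerDr.
Qed.

Lemma exp_trunc_homo T z : 0 <= T -> 0 <= z ->
  {homo exp_trunc T z : x y / x <= y}.
Proof.
move=> T0 z0 x y xy; rewrite ler_expR ler_wpM2l// le_min !ge_min lexx orbT andbT.
by rewrite ler_wpM2l.
Qed.

Lemma cst_C_bLip c : C_bLip (fun _ : R => c).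
Proof.
exists (1 + `|c|); split; first by rewrite ltr_wpDr.
by split=> x => [|y]; rewrite ?lerDr// subrr normr0 mulr_ge0 ?addr_ge0.
Qed.

End lipschitz_functions.

(** * Closure properties of the random variables, bounds for the expectation, subadditivity of the
    capacity *)

Section sublinear_expectation_theory.
Context {R : realType} {d : measure_display} {Omega : measurableType d}.
Variable E : sublinear_space R Omega.
Implicit Types (X Y : Omega -> R) (A B : set Omega).

(** A constant is a function of zero random variables. *)
Lemma rv_cst (c : R) : rv E (cst c).
Proof.
apply: (@rv_lLip _ _ _ E 0 (fun=> c) (fun _ _ => 0)); last by case.
exists 1, 0%N; split=> // x y.
by rewrite subrr normr0 !mulr_ge0 ?addr_ge0 ?exprn_ge0 ?sqrtr_ge0.
Qed.

Lemma rv_comp (phi : R -> R) X : C_lLip Num.norm phi -> rv E X -> rv E (phi \o X).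
Proof.
move=> [C [m [C0 H]]] rX.
have := @rv_lLip _ _ _ E 1 (fun v => phi (v ord0 ord0)) (fun=> X).
rewrite (_ : (fun w => _) = phi \o X); last by apply/funext => w; rewrite !mxE.
apply=> //; exists C, m; split=> // x y.
have e1 (v : 'rV[R]_1) : euclid v = `|v ord0 ord0|.
  by rewrite /euclid big_ord1 sqrtr_sqr.
by rewrite !e1 !mxE; exact: H.
Qed.

(** The product on R^2 is in [C_lLip] with exponent 1, because coordinates are bounded by the
    Euclidean norm. *)
Lemma rvM X Y : rv E X -> rv E Y -> rv E (fun w => X w * Y w).
Proof.
move=> rX rY.
have := @rv_lLip _ _ _ E 2 (fun v => v ord0 ord0 * v ord0 (lift ord0 ord0))
  (fun i => if i == ord0 then X else Y).
rewrite (_ : (fun w => _) = fun w => X w * Y w); last first.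
  by apply/funext => w; rewrite !mxE.
apply; last by move=> i; case: ifP.
exists 1, 1%N; split=> // x y; rewrite !expr1 mul1r.
have le1 (v : 'rV[R]_2) i : `|v ord0 i| <= euclid v.
  rewrite /euclid -sqrtr_sqr ler_wsqrtr// (bigD1 i)//= lerDl sumr_ge0// => j _.
  exact: sqr_ge0.
set x0 := x _ _; set x1 := x _ _; set y0 := y _ _; set y1 := y _ _.
have -> : x0 * x1 - y0 * y1 = x0 * (x1 - y1) + y1 * (x0 - y0) by ring.
apply: le_trans (ler_normD _ _) _; rewrite !normrM.
have h0 := le1 (x - y) ord0; have h1 := le1 (x - y) (lift ord0 ord0).
rewrite !mxE -/x0 -/x1 -/y0 -/y1 in h0 h1.
apply: (@le_trans _ _ (euclid x * euclid (x - y) + euclid y * euclid (x - y))).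
  by rewrite lerD// ler_pM ?le1.
by rewrite -mulrDl ler_wpM2r ?sqrtr_ge0// -addrA lerDr.
Qed.

Lemma rv_sum (I : eqType) (r : seq I) (F : I -> Omega -> R) :
  (forall i, i \in r -> rv E (F i)) -> rv E (fun w => \sum_(i <- r) F i w).
Proof.
elim: r => [_|i r IH H].
  rewrite (_ : (fun w => _) = cst 0); first exact: rv0.
  by apply/funext => w; rewrite big_nil.
rewrite (_ : (fun w => _) = fun w => F i w + \sum_(i <- r) F i w); last first.
  by apply/funext => w; rewrite big_cons.
apply: rvD; first by apply: H; rewrite mem_head.
by apply: IH => j jr; apply: H; rewrite in_cons jr orbT.
Qed.

Lemma rv_prod (I : eqType) (r : seq I) (F : I -> Omega -> R) :
  (forall i, i \in r -> rv E (F i)) -> rv E (fun w => \prod_(i <- r) F i w).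
Proof.
elim: r => [_|i r IH H].
  rewrite (_ : (fun w => _) = cst 1); first exact: rv_cst.
  by apply/funext => w; rewrite big_nil.
rewrite (_ : (fun w => _) = fun w => F i w * \prod_(i <- r) F i w); last first.
  by apply/funext => w; rewrite big_cons.
apply: rvM; first by apply: H; rewrite mem_head.
by apply: IH => j jr; apply: H; rewrite in_cons jr orbT.
Qed.

Lemma sexp_ge_cst X (c : R) : rv E X -> (forall w, c <= X w) -> (c%:E <= sexp E X)%E.
Proof. by move=> rX h; rewrite -(sexp_cst E c); apply: sexp_le => //; exact: rv_cst. Qed.

Lemma sexp_le_cst X (c : R) : rv E X -> (forall w, X w <= c) -> (sexp E X <= c%:E)%E.
Proof. by move=> rX h; rewrite -(sexp_cst E c); apply: sexp_le => //; exact: rv_cst. Qed.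

Lemma sexp_bounded_fin_num X (c : R) : rv E X -> (forall w, `|X w| <= c) ->
  sexp E X \is a fin_num.
Proof.
move=> rX h; rewrite fin_numElt.
apply/andP; split.
  rewrite (@lt_le_trans _ _ (- c)%:E) ?ltNyr//; apply: sexp_ge_cst => // w.
  by have := h w; rewrite ler_norml => /andP[].
rewrite (@le_lt_trans _ _ c%:E) ?ltry//; apply: sexp_le_cst => // w.
by have := h w; rewrite ler_norml => /andP[].
Qed.

(** Real upper bounds exclude the value +oo, so the sum on the right of subadditivity is always
    defined. *)
Lemma sexpD_le X Y (x y : R) : rv E X -> rv E Y ->
  (sexp E X <= x%:E)%E -> (sexp E Y <= y%:E)%E ->
  (sexp E (fun w => (X w + Y w)%R) <= (x + y)%:E)%E.
Proof.
move=> rX rY hx hy; rewrite EFinD; apply: le_trans (leeD hx hy).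
apply: sexpD => //; apply: ltpinfty_adde_def; rewrite inE.
  by rewrite (le_lt_trans hx)// ltry.
by rewrite (le_lt_trans hy)// ltry.
Qed.

Lemma sexpZ_le X (c x : R) : rv E X -> 0 <= c -> (sexp E X <= x%:E)%E ->
  (sexp E (fun w => (c * X w)%R) <= (c * x)%:E)%E.
Proof.
move=> rX; rewrite le_eqVlt => /predU1P[<- _|c0 hx].
  rewrite (_ : (fun w => _) = cst 0); first by rewrite sexp_cst mul0r.
  by apply/funext => w; rewrite mul0r.
by rewrite sexpZ// EFinM lee_wpmul2l// lee_fin ltW.
Qed.

Lemma sexp_sum_le (I : eqType) (r : seq I) (F : I -> Omega -> R) (c : I -> R) :
  (forall i, i \in r -> rv E (F i) /\ (sexp E (F i) <= (c i)%:E)%E) ->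
  (sexp E (fun w => (\sum_(i <- r) F i w)%R) <= (\sum_(i <- r) c i)%:E)%E.
Proof.
elim: r => [_|i r IH H].
  rewrite (_ : (fun w => _) = cst 0); first by rewrite sexp_cst big_nil.
  by apply/funext => w; rewrite big_nil.
rewrite (_ : (fun w => _) = fun w => F i w + \sum_(i <- r) F i w); last first.
  by apply/funext => w; rewrite big_cons.
rewrite big_cons.
have [rF hF] := H i (mem_head _ _).
have Hr j : j \in r -> rv E (F j) /\ (sexp E (F j) <= (c j)%:E)%E.
  by move=> jr; apply: H; rewrite in_cons jr orbT.
apply: sexpD_le => //; last exact: IH.
by apply: rv_sum => j /Hr[].
Qed.

(** Boundedness of [f] supplies the two finiteness premises. *)
Lemma identically_distributed_bLip X Y (f : R -> R) :
  rv E X -> rv E Y -> identically_distributed E X Y -> C_bLip f ->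
  sexp E (f \o X) = sexp E (f \o Y).
Proof.
move=> rX rY XY fb; have fl := C_bLip_C_lLip fb; have [C [C0 [fC _]]] := fb.
apply: XY => //.
- by apply: (@sexp_bounded_fin_num _ C) => [|w]; [exact: rv_comp|exact: fC].
- by apply: (@sexp_bounded_fin_num _ C) => [|w]; [exact: rv_comp|exact: fC].
Qed.

Lemma capacity_le_sexp A xi : rv E xi -> (forall w, A w -> 1 <= xi w) ->
  (forall w, 0 <= xi w) -> (capacity E A <= sexp E xi)%E.
Proof.
move=> rxi h1 h0; apply: ereal_inf_lbound; exists xi => //; split=> // w.
rewrite indicE; case: (boolP (w \in A)) => [|_]; last exact: h0.
by rewrite inE => /h1.
Qed.

Lemma capacity_ge0 A : (0 <= capacity E A)%E.
Proof.
apply: le_ereal_inf_tmp => _ [xi [rxi h] <-]; apply: sexp_ge_cst => // w.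
by apply: le_trans (h w); rewrite indicE.
Qed.

Lemma capacity_le1 A : (capacity E A <= 1)%E.
Proof.
rewrite -(sexp_cst E 1); apply: capacity_le_sexp => //; exact: rv_cst.
Qed.

Lemma capacity_fin_num A : capacity E A \is a fin_num.
Proof.
rewrite ge0_fin_numE ?capacity_ge0// (le_lt_trans (capacity_le1 A))//.
exact: ltry.
Qed.

(** The capacity lies between 0 and 1, so passing to its real value loses nothing. *)
Definition capr A : R := fine (capacity E A).

Lemma caprE A : capacity E A = (capr A)%:E.
Proof. by rewrite /capr fineK// capacity_fin_num. Qed.

Lemma capr_ge0 A : 0 <= capr A.
Proof. by rewrite -lee_fin -caprE capacity_ge0. Qed.

Lemma capr_le1 A : capr A <= 1.
Proof. by rewrite -lee_fin -caprE capacity_le1. Qed.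

Lemma le_capr A B : A `<=` B -> capr A <= capr B.
Proof.
move=> AB; rewrite -lee_fin -!caprE; apply: ereal_inf_le_tmp => _ [xi [rxi h] <-].
exists xi => //; split=> // w; apply: le_trans (h w).
rewrite !indicE; case: (boolP (w \in A)) => // wA.
by rewrite mem_set//; apply: AB; rewrite inE in wA.
Qed.

Lemma caprT : capr setT = 1.
Proof.
apply/eqP; rewrite eq_le capr_le1/= -lee_fin -caprE.
apply: le_ereal_inf_tmp => _ [xi [rxi h] <-]; apply: sexp_ge_cst => // w.
by have := h w; rewrite indicE in_setT.
Qed.

(** The sum of two nearly optimal majorants of the indicators is a majorant for the union. *)
Lemma caprU A B : capr (A `|` B) <= capr A + capr B.
Proof.
apply/ler_addgt0Pr => e e0.
have e20 : 0 < e / 2 by lra.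
have [_ [xA [rA hA] <-] lA] := lb_ereal_inf_adherent e20 (capacity_fin_num A).
have [_ [xB [rB hB] <-] lB] := lb_ereal_inf_adherent e20 (capacity_fin_num B).
move: lA lB; rewrite -/(capacity E A) -/(capacity E B) !caprE -!EFinD => lA lB.
rewrite -lee_fin -caprE.
have -> : capr A + capr B + e = (capr A + e / 2) + (capr B + e / 2) by lra.
apply: le_trans (sexpD_le rA rB (ltW lA) (ltW lB)).
have posA w : 0 <= xA w by apply: le_trans (hA w); rewrite indicE.
have posB w : 0 <= xB w by apply: le_trans (hB w); rewrite indicE.
apply: capacity_le_sexp => [|w AB|w]; first exact: rvD.
  case: AB => [Aw|Bw].
    have h : 1 <= xA w by have := hA w; rewrite indicE mem_set.
    by have := posB w; lra.
  have h : 1 <= xB w by have := hB w; rewrite indicE mem_set.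
  by have := posA w; lra.
by rewrite addr_ge0.
Qed.

(** Every majorant of the indicator of [A] also majorizes Y/k. This is the converse direction to
    [capacity_le_sexp]. *)
Lemma sexp_le_capr Y A (k : R) : 0 < k -> rv E Y ->
  (forall w, Y w <= k) -> (forall w, ~ A w -> Y w <= 0) ->
  (sexp E Y <= (k * capr A)%:E)%E.
Proof.
move=> k0 rY Yk Y0.
suff : (sexp E (fun w => k^-1 * Y w)%R <= capacity E A)%E.
  rewrite caprE => h; have := sexpZ_le (rvZ _ rY) (ltW k0) h.
  rewrite (_ : (fun w => _) = Y)//.
  by apply/funext => w; rewrite mulrA divff ?gt_eqF// mul1r.
apply: le_ereal_inf_tmp => _ [xi [rxi h] <-]; apply: sexp_le => //; first exact: rvZ.
move=> w; apply: le_trans (h w); rewrite indicE.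
rewrite mulrC ler_pdivrMr//; case: (boolP (w \in A)) => [_|].
  by rewrite mul1r.
by rewrite notin_setE mul0r => /Y0.
Qed.

End sublinear_expectation_theory.

(** * Choquet expectations and exponential moments *)

Section moments_and_tails.
Context {R : realType} {d : measure_display} {Omega : measurableType d}.
Variable E : sublinear_space R Omega.
Implicit Types (X Y : Omega -> R).

(** Doubling makes theta_{k+1} / 2 at most the length of the interval from theta_k to theta_{k+1},
    on which the nonincreasing tail is at least its value at the right end. The sum is thus
    controlled by the Choquet integral. *)
Lemma choquet_tail_sum Y (theta : nat -> R) : (forall w, 0 <= Y w) ->
  (choquet E Y < +oo)%E -> (forall k, 0 <= theta k) ->
  (forall k, 2 * theta k <= theta k.+1) ->
  exists D : R, forall N,
    \sum_(k < N) theta k.+1 * capr E [set w | theta k.+1 <= Y w] <= D.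
Proof.
move=> Y0 Yfin t0 t2.
pose F (t : R) := capr E [set w | t <= Y w].
have Fni : nonincreasing_fun F.
  by move=> s t st; apply: le_capr => w /=; exact: le_trans.
have mF (A : set R) : measurable A -> measurable_fun A (EFin \o F).
  by move=> mA; apply/measurable_EFinP; exact: nonincreasing_measurable.
have F0 t : (0 <= (F t)%:E)%E by rewrite lee_fin capr_ge0.
have fin1 : (\int[lebesgue_measure]_(t in `[(0 : R)%R, +oo[) (F t)%:E < +oo)%E.
  move: Yfin; rewrite /choquet.
  (* For [t <= 0] the event is the whole space, of capacity 1, so the negative half of the Choquet
     integral vanishes. *)
  rewrite [X in (_ + X)%E](_ : _ = 0%E) ?adde0; last first.
    apply: integral0_eq => t; rewrite /= in_itv /= => t_le0.
    rewrite caprE (_ : [set w | _] = setT) ?caprT ?subee//.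
    by apply/seteqP; split => // w _ /=; exact: le_trans (Y0 w).
  congr (_ < _)%E; apply: eq_integral => t _; exact: caprE.
have part N : ((\sum_(k < N) theta k.+1 / 2 * F (theta k.+1))%:E <=
    \int[lebesgue_measure]_(t in `[0%R, theta N]) (F t)%:E)%E.
  elim: N => [|N IH]; first by rewrite big_ord0; exact: integral_ge0.
  have tN : theta N <= theta N.+1 by have := t2 N; have := t0 N; lra.
  have -> : `[0%R, theta N.+1]%classic =
      (`[0%R, theta N]%classic `|` `]theta N, theta N.+1]%classic : set R).
    apply/seteqP; split => x /=; rewrite !in_itv /=.
      move=> /andP[h1 h2]; case: (leP x (theta N)) => h3; first by left; rewrite h1.
      by right; rewrite h2.
    by have := t0 N; move=> h0 [] /andP[h1 h2]; apply/andP; split; lra.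
  rewrite ge0_integral_setU//=; first last.
  - apply/disj_setPS => x [] /=; rewrite !in_itv /= => /andP[_ h1] /andP[h2 _].
    by move: h2; rewrite ltNge h1.
  - apply: mF; exact: measurableU.
  rewrite big_ord_recr /= EFinD leeD//.
  apply: (@le_trans _ _ (\int[lebesgue_measure]_(t in `]theta N, theta N.+1])
      (cst (F (theta N.+1))%:E t))%E).
    rewrite integral_cst//= lebesgue_measure_itv /= lte_fin.
    case: ltP => h; last first.
      have -> : theta N.+1 = 0 by have := t2 N; have := t0 N; lra.
      by rewrite !mul0r mule0.
    rewrite -EFinD -EFinM lee_fin mulrC ler_wpM2l ?capr_ge0//.
    by have := t2 N; lra.
  apply: ge0_le_integral => //; first by move=> t _; exact: F0.
    by apply: mF; exact: measurable_itv.
  move=> t /=; rewrite in_itv /= => /andP[_ h]; rewrite lee_fin; exact: Fni.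
exists (2 * fine (\int[lebesgue_measure]_(t in `[(0 : R)%R, +oo[) (F t)%:E)%E) => N.
have : ((\sum_(k < N) theta k.+1 / 2 * F (theta k.+1))%:E <=
    \int[lebesgue_measure]_(t in `[(0 : R)%R, +oo[) (F t)%:E)%E.
  apply: le_trans (part N) _; apply: ge0_subset_integral => //; first exact: mF.
  by move=> x /=; rewrite !in_itv /= => /andP[->].
rewrite -[leRHS]fineK; last by rewrite ge0_fin_numE//; exact: integral_ge0.
rewrite lee_fin => h.
rewrite -ler_pdivrMl// big_distrr /= (le_trans _ h)//; apply: ler_sum => k _.
by rewrite /F mulrA [_^-1 * _]mulrC.
Qed.

(** The tail is not integrated, as the expectation is only finitely subadditive. Instead, with x+ =
    max(0, x), min(x+, c) splits into min(x+, c/2) and min((x - c/2)+, c/2); the second part has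
    expectation at most c/2 times the capacity of [X >= c/2], and the first is halved again. *)
Lemma truncated_mean_le X (s C : R) : rv E X -> s < 1 ->
  (forall x, 0 < x -> capr E [set w | x <= X w] <= C * x `^ (- s)) ->
  exists D : R, 0 <= D /\ forall c, 0 < c ->
    (sexp E (fun w => (Num.min (Num.max 0 (X w)) c)%R) <= (D * c `^ (1 - s))%:E)%E.
Proof.
move=> rX s1 tail.
have C0 : 0 <= C.
  by have := tail 1 ltr01; rewrite powR1 mulr1; apply: le_trans; exact: capr_ge0.
have lip (f : R -> R) : (forall x y, `|f x - f y| <= `|x - y|) -> rv E (f \o X).
  move=> h; apply: rv_comp => //; apply: (@lipschitz_C_lLip _ 1) => // x y.
  by rewrite mul1r.
pose phi c x : R := Num.min (Num.max 0 x) c.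
have phi_lip c x y : `|phi c x - phi c y| <= `|x - y|.
  exact: le_trans (norm_min_sub _ _ _) (norm_max_sub _ _ _).
have rphi c : rv E (fun w => phi c (X w)) by apply: (lip (phi c)).
have rpsi c : rv E (fun w => phi c (X w - c)).
  apply: (lip (fun x => phi c (x - c))) => x y; apply: le_trans (phi_lip _ _ _) _.
  by rewrite opprB addrA subrK.
set h : R := 2 `^ (- (1 - s)).
have h1 : h < 1.
  by rewrite /h -[ltRHS](powRr0 2) /powR !gt_eqF// ltr_expR ltr_pM2r ?ln_gt0//; lra.
have h0 : 0 < h by rewrite powR_gt0.
(* [D] solves the halving recursion [D * h + C * h = D], where [h] is the factor by which halving
   [c] changes c^(1 - s). *)
pose D := C * h / (1 - h).
have D0 : 0 <= D by rewrite divr_ge0 ?mulr_ge0 ?(ltW h0)//; lra.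
have DE : D * h + C * h = D by rewrite /D; field; lra.
have halfE c : 0 < c -> (c / 2) `^ (1 - s) = h * c `^ (1 - s).
  move=> c0; rewrite powRM ?(ltW c0)// mulrC /h powRN; congr (_ * _).
  by rewrite -powR_inv1// powRAC powR_inv1 ?powR_ge0.
clearbody D h.
(* After [N] halvings the remaining truncated variable is bounded by c / 2^N. This remainder is sent
   to 0 at the end. *)
have ind N : forall c, 0 < c ->
    (sexp E (fun w => phi c (X w)) <= (D * c `^ (1 - s) + c / 2 ^+ N)%:E)%E.
  elim: N => [|N IH] c c0.
    apply: sexp_le_cst => // w; rewrite expr0 divr1.
    apply: (@le_trans _ _ c); first by rewrite /phi ge_min lexx orbT.
    by rewrite lerDr mulr_ge0 ?powR_ge0.
  have c20 : 0 < c / 2 by lra.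
  have := sexpD_le (rphi _) (rpsi _) (IH _ c20)
    (@sexp_le_capr _ _ _ E (fun w => phi (c / 2) (X w - c / 2))
       [set w | c / 2 <= X w] (c / 2) c20 (rpsi _) _ _).
  rewrite (_ : (fun w => _ + _) = (fun w => phi c (X w))); last first.
    apply/funext => w; rewrite /phi; set x := X w.
    by case: (leP 0 x); case: (leP 0 (x - c / 2)) => h2 h3;
      rewrite ?(max_r h2) ?(max_l (ltW h2));
      do ![case: leP => ?]; lra.
  move=> /(_ _ _)/le_trans; apply.
  - by move=> w; rewrite /phi ge_min lexx orbT.
  - by move=> w /= /negP; rewrite -ltNge => hw; rewrite /phi max_l ?min_l//; lra.
  rewrite lee_fin.
  have tc : c / 2 * capr E [set w | c / 2 <= X w] <= C * (h * c `^ (1 - s)).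
    rewrite -halfE// powRD; last first.
      by rewrite (gt_eqF c20) implybT.
    rewrite powRr1 ?(ltW c20)// mulrCA ler_wpM2l ?(ltW c20)//; exact: tail.
  rewrite halfE// exprS invfM.
  have := DE => /(congr1 (fun z => z * c `^ (1 - s))); rewrite mulrDl.
  by set P := c `^ (1 - s) in tc *; lra.
exists D; split=> // c c0; apply/lee_addgt0Pr => e e0.
have [N HN] : exists N : nat, c / e < N%:R.
  by exists (Num.truncn (c / e)).+1; rewrite truncnS_gt.
apply: le_trans (ind N c c0) _; rewrite -EFinD lee_fin lerD2l.
rewrite ler_pdivrMr ?exprn_gt0// -ler_pdivrMl// mulrC (le_trans (ltW HN))//.
by rewrite -natrX ler_nat ltnW// ltn_expl.
Qed.

End moments_and_tails.

(** * Exponential moments and the Markov-type inequality for weighted sums *)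

Section exponential_bounds.
Context {R : realType} {d : measure_display} {Omega : measurableType d}.
Variable E : sublinear_space R Omega.
Implicit Types (X Y : Omega -> R).

(** From exp v <= 1 + v exp T on [0, T], the exponential is at most 1 + T z exp T min(max(0, X),
    1/z). The truncated mean at level 1/z turns the factor z into z^s, and T exp T <= exp(2T). *)
Lemma exp_moment_tail X (s C : R) : rv E X -> s < 1 ->
  (forall x, 0 < x -> capr E [set w | x <= X w] <= C * x `^ (- s)) ->
  exists D : R, 0 <= D /\ forall z T, 0 <= z -> 0 <= T ->
    (sexp E (exp_trunc T z \o X) <= (1 + D * expR (3 * T) * z `^ s)%:E)%E.
Proof.
move=> rX s1 tail; have [D [D0 HD]] := truncated_mean_le rX s1 tail.
(* The case z = 0 is separate because the truncation level is 1/z. *)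
exists D; split=> // z T; rewrite le_eqVlt => /predU1P[<- T0|z0 T0].
  apply: sexp_le_cst.
    by apply: rv_comp => //; apply: C_bLip_C_lLip; exact: exp_trunc_C_bLip.
  move=> w; rewrite /= /exp_trunc mul0r min_l// mulr0 expR0 lerDl.
  by rewrite !mulr_ge0 ?expR_ge0 ?powR_ge0.
have zV : 0 < z^-1 by rewrite invr_gt0.
have rmin : rv E (fun w => Num.min (Num.max 0 (X w)) z^-1).
  apply: (@rv_comp _ _ _ E (fun x => Num.min (Num.max 0 x) z^-1)) => //.
  apply: (@lipschitz_C_lLip _ 1) => // x y; rewrite mul1r.
  exact: le_trans (norm_min_sub _ _ _) (norm_max_sub _ _ _).
have k0 : 0 <= expR T * T * z by rewrite !mulr_ge0 ?expR_ge0// ltW.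
have h1 : (sexp E (cst (1%R : R)) <= 1%:E)%E by rewrite sexp_cst.
have h2 := sexpD_le (rv_cst E 1) (rvZ _ rmin) h1 (sexpZ_le rmin k0 (HD _ zV)).
apply: le_trans (le_trans _ h2) _.
- apply: sexp_le.
  + by apply: rvD; [exact: rv_cst|exact: rvZ].
  + by apply: rv_comp => //; apply: C_bLip_C_lLip; exact: exp_trunc_C_bLip.
  move=> w; rewrite /= /exp_trunc; set x := X w.
  have [x0|x0] := leP x 0.
    rewrite (min_l (ltW zV)) mulr0 addr0 -expR0 ler_expR.
    rewrite mulr_ge0_le0// ge_min; apply/orP; left.
    by rewrite mulr_ge0_le0// ltW.
  have -> : Num.min (z * x) 1 = z * Num.min x z^-1.
    by rewrite minr_pMr ?(ltW z0)// divff// gt_eqF.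
  set v := T * (z * Num.min x z^-1).
  have v0 : 0 <= v by rewrite !mulr_ge0 ?(ltW z0)// le_min !ltW.
  have vT : v <= T.
    rewrite /v ler_piMr// mulrC -ler_pdivlMr// mul1r.
    by rewrite ge_min lexx orbT.
  rewrite (_ : _ * _ = expR T * v); last by rewrite /v !mulrA.
  have ev : expR v * (1 - v) <= 1.
    rewrite -[leRHS](@expRxMexpNx_1 R v) ler_pM2l ?expR_gt0//.
    by have := expR_ge1Dx (- v); lra.
  have : expR v <= expR T by rewrite ler_expR.
  nra.
rewrite lee_fin lerD2l.
have -> : expR T * T * z * (D * z^-1 `^ (1 - s)) = D * (expR T * T) * (z * z^-1 `^ (1 - s)).
  by ring.
have -> : z * z^-1 `^ (1 - s) = z `^ s.
  rewrite -powR_inv1 ?(ltW z0)// -powRrM mulN1r opprB.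
  rewrite -{1}[z]powRr1 ?(ltW z0)// -powRD; last by rewrite (gt_eqF z0) implybT.
  by congr (_ `^ _); lra.
rewrite ler_wpM2r ?powR_ge0// ler_wpM2l//.
have -> : 3 * T = T + (T + T) by lra.
rewrite expRD ler_wpM2l ?expR_ge0//.
apply: le_trans (_ : _ <= expR T) _; last by rewrite ler_expR lerDl.
by rewrite (le_trans _ (expR_ge1Dx _))// lerDr.
Qed.

(** Apply the second-order bound to v = T min(z X, 1) <= T. The linear term is at most T z X, of
    nonpositive expectation, and |v| <= T z |X|. Finally T^s <= (1 + T)^2 <= exp(2T). *)
Lemma exp_moment_centered X (s C : R) : rv E X -> 1 <= s -> s <= 2 ->
  (sexp E X <= 0)%E -> (sexp E (fun w => (`|X w| `^ s)%R) <= C%:E)%E ->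
  exists D : R, 0 <= D /\ forall z T, 0 <= z -> 0 <= T ->
    (sexp E (exp_trunc T z \o X) <= (1 + D * expR (3 * T) * z `^ s)%:E)%E.
Proof.
move=> rX s1 s2 EX EXs.
have rXs : rv E (fun w => `|X w| `^ s).
  by apply: (@rv_comp _ _ _ E (fun x => `|x| `^ s)) => //; exact: powR_norm_C_lLip.
have C0 : 0 <= C.
  rewrite -lee_fin (le_trans _ EXs)//; apply: sexp_ge_cst => // w; exact: powR_ge0.
exists (4 * C); split=> [|z T z0 T0]; first by rewrite mulr_ge0.
pose k := 4 * expR T * (T * z) `^ s.
have k0 : 0 <= k by rewrite !mulr_ge0 ?expR_ge0 ?powR_ge0.
have Tz0 : 0 <= T * z by rewrite mulr_ge0.
have h1 : (sexp E (cst (1%R : R)) <= 1%:E)%E by rewrite sexp_cst.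
have h2 := sexpD_le (rvD (rv_cst E 1) (rvZ (T * z) rX)) (rvZ k rXs)
  (sexpD_le (rv_cst E 1) (rvZ _ rX) h1 (sexpZ_le rX Tz0 EX)) (sexpZ_le rXs k0 EXs).
apply: le_trans (le_trans _ h2) _.
- apply: sexp_le.
  + by apply: rvD; [apply: rvD; [exact: rv_cst|exact: rvZ]|exact: rvZ].
  + by apply: rv_comp => //; apply: C_bLip_C_lLip; exact: exp_trunc_C_bLip.
  move=> w; rewrite /= /exp_trunc; set x := X w.
  set v := T * Num.min (z * x) 1.
  have vT : v <= T by rewrite /v ler_piMr// ge_min lexx orbT.
  have vx : v <= T * z * x by rewrite -mulrA ler_wpM2l// ge_min lexx.
  have vn : `|v| <= T * z * `|x|.
    rewrite /v normrM ger0_norm// -mulrA ler_wpM2l//.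
    have zx : z * x <= z * `|x| by rewrite ler_wpM2l// ler_norm.
    case: (leP (z * x) 1) => h3; first by rewrite normrM ger0_norm.
    by rewrite normr1; lra.
  have vs : `|v| `^ s <= (T * z) `^ s * `|x| `^ s.
    rewrite -powRM//; apply: ge0_ler_powR; rewrite ?nnegrE ?mulr_ge0//; lra.
  have e0 := expR_gt0 T.
  apply: le_trans (expR_le_second_order vT T0 s1 s2) _.
  apply: lerD; first by rewrite lerD2l.
  rewrite /k -!mulrA ler_pM2l// ler_pM2l//.
rewrite lee_fin mulr0 addr0 lerD2l /k.
rewrite powRM// (_ : _ * C = 4 * C * (expR T * T `^ s) * z `^ s); last by ring.
rewrite ler_wpM2r ?powR_ge0// ler_wpM2l ?mulr_ge0//.
have -> : 3 * T = T + (T + T) by lra.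
rewrite expRD ler_wpM2l ?expR_ge0//.
have T1 : 1 <= 1 + T by lra.
apply: (@le_trans _ _ ((1 + T) `^ s)).
  by apply: ge0_ler_powR; rewrite ?nnegrE; lra.
apply: (@le_trans _ _ ((1 + T) `^ 2)); first by apply: ler_powR.
rewrite powR_mulrn ?(le_trans _ T1)// expRD -expr2.
by rewrite lerXn2r ?nnegrE ?expR_ge0 ?expR_ge1Dx// (le_trans _ T1).
Qed.

(* Either all the truncated variables [min (a_i X_i) b] agree with [a_i X_i], and Markov's
   inequality for the exponential applies, or one of the ramps equals 1. *)
Lemma weighted_sum_capacity_le X (Xs : nat -> Omega -> R) (K : R) (n : nat)
    (a M : nat -> R) (T b y : R) :
  rv E X -> (forall i, (1 <= i)%N -> rv E (Xs i)) ->
  (forall i, (1 <= i)%N -> identically_distributed E (Xs i) X) ->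
  0 <= K ->
  (forall f : nat -> R -> R,
      (forall i, (1 <= i)%N ->
         [/\ C_bLip (f i), (forall x, 0 <= f i x) & {homo f i : x y / x <= y}]) ->
      forall n, (1 <= n)%N ->
        (sexp E (fun w => (\prod_(1 <= i < n.+1) f i (Xs i w))%R)
         <= K%:E * \prod_(1 <= i < n.+1) sexp E (f i \o Xs i))%E) ->
  (1 <= n)%N -> (forall i, (1 <= i <= n)%N -> 0 <= a i) -> 0 <= T -> 0 < b ->
  (forall i, (1 <= i <= n)%N -> (sexp E (exp_trunc T (a i / b) \o X) <= (M i)%:E)%E) ->
  capr E [set w | y < \sum_(1 <= i < n.+1) a i * Xs i w] <=
  \sum_(1 <= i < n.+1) capr E [set w | 1/2 <= a i / b * `|X w|] +
  expR (- (T * y / b)) * (K * \prod_(1 <= i < n.+1) M i).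
Proof.
move=> rX rXs ids K0 HK n1 a0 T0 b0 HM.
(* The dependence inequality asks for an infinite family of functions, so the indices outside 1..n
   receive the constant 1. *)
pose g i : R -> R := if (1 <= i <= n)%N then exp_trunc T (a i / b) else fun=> 1.
have inP i : i \in index_iota 1 n.+1 -> (1 <= i <= n)%N by rewrite mem_index_iota ltnS.
have z0 i : (1 <= i <= n)%N -> 0 <= a i / b by move=> /a0 ai; rewrite divr_ge0 ?(ltW b0).
have gP i : [/\ C_bLip (g i), (forall x, 0 <= g i x) & {homo g i : x y / x <= y}].
  rewrite /g; case: ifPn => [/z0 z0i|_]; split=> //.
  - exact: exp_trunc_C_bLip.
  - exact: exp_trunc_ge0.
  - exact: exp_trunc_homo.
  - exact: cst_C_bLip.
have gl i : C_lLip Num.norm (g i) by apply: C_bLip_C_lLip; case: (gP i).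
pose rp i w := ramp (a i / b) (Xs i w).
have rrp i : i \in index_iota 1 n.+1 -> rv E (rp i).
  move=> /inP/andP[i1 _]; apply: (@rv_comp _ _ _ E (ramp (a i / b))); last exact: rXs.
  by apply: C_bLip_C_lLip; exact: ramp_C_bLip.
have hrp i : i \in index_iota 1 n.+1 ->
    (sexp E (rp i) <= (capr E [set w | 1/2 <= a i / b * `|X w|])%:E)%E.
  move=> ii; have /andP[i1 i_n] := inP _ ii.
  have -> : sexp E (rp i) = sexp E (ramp (a i / b) \o X).
    apply: (identically_distributed_bLip (rXs i i1) rX (ids i i1)); exact: ramp_C_bLip.
  rewrite -[X in (_ <= X%:E)%E]mul1r; apply: sexp_le_capr => //.
  - by apply: rv_comp => //; apply: C_bLip_C_lLip; exact: ramp_C_bLip.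
  - by move=> w; exact: ramp_le1.
  move=> w /= /negP; rewrite -ltNge => h; rewrite ramp_eq0//.
  by rewrite (le_trans _ (ltW h))// ler_wpM2l ?ler_norm// (z0 i (inP _ ii)).
have rg i : i \in index_iota 1 n.+1 -> rv E (fun w => g i (Xs i w)).
  by move=> /inP/andP[i1 _]; apply: (@rv_comp _ _ _ E (g i)) => //; exact: rXs.
have rprod := rv_prod rg.
have hprod : (sexp E (fun w => (\prod_(1 <= i < n.+1) g i (Xs i w))%R)
    <= (K * \prod_(1 <= i < n.+1) M i)%:E)%E.
  apply: le_trans (HK g (fun i _ => gP i) n n1) _.
  rewrite EFinM lee_wpmul2l ?lee_fin//.
  (* The extended-real product is compared factor by factor, carrying along that each partial
     product is a nonnegative real. *)
  suff [m [-> /andP[_ mM]]] : exists m : R,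
      (\prod_(1 <= i < n.+1) sexp E (g i \o Xs i) = m%:E)%E /\
      0 <= m <= \prod_(1 <= i < n.+1) M i by rewrite lee_fin.
  rewrite !big_seq; apply: (big_ind2 (fun (u : \bar R) (v : R) =>
      exists m : R, u = m%:E /\ 0 <= m <= v)).
  - by exists 1; rewrite ler01 lexx.
  - move=> _ v1 _ v2 [m1 [-> /andP[m10 mv1]]] [m2 [-> /andP[m20 mv2]]].
    by exists (m1 * m2); rewrite EFinM mulr_ge0//= ler_pM.
  move=> i /inP ii; have /andP[i1 _] := ii.
  have -> : sexp E (g i \o Xs i) = sexp E (exp_trunc T (a i / b) \o X).
    rewrite /g ii; apply: (identically_distributed_bLip (rXs i i1) rX (ids i i1)).
    exact: exp_trunc_C_bLip.
  have h0 : (0 <= sexp E (exp_trunc T (a i / b) \o X))%E.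
    apply: sexp_ge_cst => [|w]; last exact: exp_trunc_ge0.
    by apply: rv_comp => //; apply: C_bLip_C_lLip; exact: exp_trunc_C_bLip.
  have hM := HM i ii.
  exists (fine (sexp E (exp_trunc T (a i / b) \o X))).
  have fin : sexp E (exp_trunc T (a i / b) \o X) \is a fin_num.
    by rewrite ge0_fin_numE// (le_lt_trans hM)// ltry.
  by rewrite fineK// fine_ge0//= -lee_fin fineK.
rewrite -lee_fin -caprE.
apply: le_trans (sexpD_le (rv_sum rrp) (rvZ _ rprod)
  (sexp_sum_le (fun i ii => conj (rrp i ii) (hrp i ii)))
  (sexpZ_le rprod (expR_ge0 (- (T * y / b))) hprod)).
have rp0 w : 0 <= \sum_(1 <= i < n.+1) rp i w.
  by apply: sumr_ge0 => i _; exact: ramp_ge0.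
have pr0 w : 0 <= \prod_(1 <= i < n.+1) g i (Xs i w).
  by apply: prodr_ge0 => i _; case: (gP i).
apply: capacity_le_sexp => [|w /= yw|w].
- by apply: rvD; [exact: rv_sum|exact: rvZ].
- have [[i [ii h]]|nex] := pselect (exists i, i \in index_iota 1 n.+1 /\ 1 <= a i / b * Xs i w).
    rewrite (le_trans (_ : 1 <= \sum_(1 <= i < n.+1) rp i w))//; last first.
      by rewrite lerDl mulr_ge0 ?expR_ge0.
    rewrite (bigD1_seq i)//= ?iota_uniq// {1}/rp ramp_eq1// lerDl.
    by apply: sumr_ge0 => j _; exact: ramp_ge0.
  rewrite (le_trans _ (_ : expR (- (T * y / b)) * (\prod_(1 <= i < n.+1) g i (Xs i w)) <= _))//; last first.
    by rewrite lerDr.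
  (* No [a i * Xs i w] reaches [b] here, so the truncations are inactive and the product is the
     exponential of the whole sum. *)
  have -> : \prod_(1 <= i < n.+1) g i (Xs i w) =
      expR (\sum_(1 <= i < n.+1) T * (a i / b * Xs i w)).
    rewrite expR_sum big_seq [RHS]big_seq; apply: eq_bigr => i ii.
    rewrite /g (inP _ ii) /exp_trunc min_l// leNgt; apply/negP => h; apply: nex.
    by exists i; split=> //; exact: ltW.
  rewrite -expRD -expR0 ler_expR -big_distrr /=.
  rewrite (eq_bigr (fun i => (a i * Xs i w) / b)); last by move=> i _; rewrite mulrAC.
  rewrite -big_distrl /= addrC -mulrA -mulrBr mulr_ge0// -mulrBl divr_ge0 ?(ltW b0)//.
  by rewrite subr_ge0 ltW.
- by rewrite addr_ge0// mulr_ge0 ?expR_ge0.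
Qed.

End exponential_bounds.

(** * Dyadic tails *)

Lemma expr_bracket (R : realType) (lam y : R) : 1 < lam -> 1 <= y ->
  exists j : nat, lam ^+ j <= y < lam ^+ j.+1.
Proof.
move=> lam1 y1; have ll : 0 < ln lam by rewrite ln_gt0.
have lam0 : 0 < lam by lra.
have y0 : 0 < y by lra.
exists (Num.truncn (ln y / ln lam)).
have := @truncn_itv _ (ln y / ln lam); case/(_ _)/andP; first by rewrite divr_ge0 ?ln_ge0// ltW.
move=> h1 h2.
have lE n : lam ^+ n = expR (n%:R * ln lam) by rewrite expRM_natl lnK.
have yE : y = expR (ln y) by rewrite lnK.
apply/andP; split; rewrite lE.
  by rewrite [leRHS]yE ler_expR -ler_pdivlMr.
by rewrite [ltLHS]yE ltr_expR -ltr_pdivrMr.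
Qed.

Lemma powR_exprn (R : realType) (x a : R) n : 0 <= x -> (x ^+ n) `^ a = (x `^ a) ^+ n.
Proof.
by move=> x0; rewrite -powR_mulrn// powRAC powR_mulrn// powR_ge0.
Qed.

Lemma powR_gt1 (R : realType) (x a : R) : 1 < x -> 0 < a -> 1 < x `^ a.
Proof.
move=> x1 a0; rewrite /powR gt_eqF; last by lra.
by rewrite expR_gt1 mulr_gt0// ln_gt0.
Qed.

Lemma ltr_powR_exp (R : realType) (x a b : R) : 1 < x -> a < b -> x `^ a < x `^ b.
Proof.
move=> x1 ab; have x0 : 0 < x by lra.
by rewrite /powR gt_eqF// ltr_expR ltr_pM2r// ln_gt0.
Qed.

(** The value of x^beta l(x) at x = 2^(j + k0). The offset [k0] skips the initial range, where slow
    variation gives no control. *)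
Definition dyadic_scale (R : realType) (l : R -> R) (beta : R) (k0 j : nat) : R :=
  (2 `^ beta) ^+ (j + k0) * l (2 ^+ (j + k0)).

Lemma dyadic_scaleP (R : realType) (l : R -> R) (beta a b : R) :
  slowly_varying l -> a < 2 `^ beta < b ->
  exists M k0, [/\ 1 <= M,
    forall j, 0 < dyadic_scale l beta k0 j,
    forall j, a * dyadic_scale l beta k0 j <= dyadic_scale l beta k0 j.+1
      <= b * dyadic_scale l beta k0 j &
    forall m lam, 1 <= lam <= 2 ->
      M^-1 * l (2 ^+ (m + k0)) <= l (lam * 2 ^+ (m + k0)) <= M * l (2 ^+ (m + k0))].
Proof.
move=> sl ab; have [M [x0 [M1 _ HM]]] := slowly_varying_bounded sl.
have u0 : 0 < 2 `^ beta :> R by rewrite powR_gt0.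
have [k1 Hk1] := slowly_varying_dyadic sl u0 ab.
pose k2 := (Num.truncn `|x0|).+1.
exists M, (maxn k1 k2); split=> // [j|j|m lam lam12].
- by have [l0 _ _] := sl; rewrite mulr_gt0 ?exprn_gt0// l0// exprn_gt0.
- by apply: Hk1; rewrite (leq_trans (leq_maxl k1 k2))// leq_addl.
apply: HM => //.
rewrite (le_trans (ler_norm x0))// (le_trans (ltW (truncnS_gt _)))//.
rewrite -natrX ler_nat; apply: leq_trans (ltnW (ltn_expl _ _)) => //.
by rewrite (leq_trans (leq_maxr k1 k2))// leq_addl.
Qed.

Section dyadic_tails.
Context {R : realType} {d : measure_display} {Omega : measurableType d}.
Context (E : sublinear_space R Omega).

(** Tail summation with the thresholds t_k / M. On the event for [j], |X|^(1/alpha) lies in a dyadic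
    block of index at least j + k0, where [l] is comparable to its value at the left end; as [t]
    increases, the Choquet variable is at least t_j / M. *)
Lemma choquet_dyadic_sum (X : Omega -> R) (l : R -> R) (p alpha M : R) (k0 : nat) :
  0 < p -> 0 < alpha -> 1 < alpha * p -> (forall x, 0 < x -> 0 < l x) -> 1 <= M ->
  (forall j, 0 < dyadic_scale l (alpha * p) k0 j) ->
  (forall j, 2 * dyadic_scale l (alpha * p) k0 j <= dyadic_scale l (alpha * p) k0 j.+1) ->
  (forall m lam, 1 <= lam <= 2 ->
      M^-1 * l (2 ^+ (m + k0)) <= l (lam * 2 ^+ (m + k0))) ->
  (choquet E (fun w => (`|X w| `^ p * l (`|X w| `^ alpha^-1))%R) < +oo)%E ->
  exists D : R, forall N, \sum_(j < N) dyadic_scale l (alpha * p) k0 j *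
    capr E [set w | (2 `^ alpha) ^+ (j + k0) <= `|X w|] <= D.
Proof.
move=> p0 alpha0 ap1 l0 M1; set t := dyadic_scale _ _ _ => t0 t2 HM fin.
have M0 : 0 < M by lra.
pose Y w := `|X w| `^ p * l (`|X w| `^ alpha^-1).
have Y0 w : 0 <= Y w.
  (* The sign of [l] at 0 is unknown, but there the factor 0^p vanishes. *)
  rewrite /Y; have [->|Xw] := eqVneq (X w) 0.
    by rewrite normr0 powR0 ?mul0r// gt_eqF.
  by rewrite mulr_ge0 ?powR_ge0// ltW// l0// powR_gt0// normr_gt0.
have th0 k : 0 <= t k / M by rewrite divr_ge0 ?ltW.
have th2 k : 2 * (t k / M) <= t k.+1 / M.
  by rewrite mulrA ler_pM2r ?invr_gt0.
have [D HD] := choquet_tail_sum Y0 fin th0 th2.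
have sub j : capr E [set w | (2 `^ alpha) ^+ (j + k0) <= `|X w|] <=
    capr E [set w | t j / M <= Y w].
  apply: le_capr => w /= hw.
  have two1 : 1 < 2 :> R by lra.
  have y_ge : 2 ^+ (j + k0) <= `|X w| `^ alpha^-1.
    have -> : 2 ^+ (j + k0) = ((2 `^ alpha) ^+ (j + k0)) `^ alpha^-1 :> R.
      by rewrite powR_exprn ?powR_ge0// -powRrM divff ?gt_eqF// powRr1.
    by apply: ge0_ler_powR; rewrite ?nnegrE ?invr_ge0 ?exprn_ge0 ?powR_ge0 ?(ltW alpha0).
  have y1 : 1 <= `|X w| `^ alpha^-1 by rewrite (le_trans _ y_ge)// exprn_ege1// ltW.
  have [i /andP[yi yi1]] := expr_bracket two1 y1.
  have ji : (j + k0 <= i)%N.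
    by rewrite -ltnS -(ltr_eXn2l two1) (le_lt_trans y_ge).
  pose m := (i - k0)%N.
  have im : i = (m + k0)%N by rewrite subnK// (leq_trans (leq_addl j k0)).
  have jm : (j <= m)%N by rewrite -(leq_add2r k0) -im.
  have tjm : t j <= t m.
    rewrite -(subnK jm); elim: (m - j)%N => [//|n IH].
    by rewrite addSn (le_trans IH)//; have := t2 (n + j)%N; have := t0 (n + j)%N; lra.
  apply: (@le_trans _ _ (t m / M)); first by rewrite ler_pM2r ?invr_gt0.
  have two_i : 0 < 2 ^+ i :> R by rewrite exprn_gt0.
  have lamP : 1 <= `|X w| `^ alpha^-1 / 2 ^+ i <= 2.
    by rewrite ler_pdivlMr// mul1r yi ler_pdivrMr// -exprS ltW.
  have := HM m _ lamP; rewrite -im divfK ?gt_eqF// => hl.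
  rewrite /t /dyadic_scale -im -mulrA [_ / M]mulrC /Y.
  rewrite ler_pM ?exprn_ge0 ?powR_ge0// ?mulr_ge0 ?invr_ge0 ?(ltW M0) ?(ltW (l0 _ _))//.
  have -> : `|X w| `^ p = (`|X w| `^ alpha^-1) `^ (alpha * p).
    by rewrite -powRrM mulrA mulVf ?mul1r// gt_eqF.
  rewrite -powR_exprn//; apply: ge0_ler_powR; rewrite ?nnegrE ?powR_ge0 ?(ltW two_i)//.
  lra.
(* The tail sum starts at index 1; the term of index 0 is bounded by [t 0], since a capacity is at
   most 1. *)
exists (t 0%N + M * D) => -[|N].
  rewrite big_ord0; have := HD 0%N; rewrite big_ord0 => D0.
  by rewrite addr_ge0 ?(ltW (t0 _))// mulr_ge0// ltW.
rewrite big_ord_recl; apply: lerD.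
  by rewrite -[leRHS]mulr1 ler_wpM2l ?capr_le1// ltW.
rewrite -ler_pdivrMl// big_distrr /=; apply: le_trans (HD N); apply: ler_sum => j _.
rewrite /= /bump add1n mulrA [M^-1 * _]mulrC ler_wpM2l//; exact: sub.
Qed.

(** Growth gives t_j >= lam^(s j) t_0, which bounds the tail at lam^(j + k0). The factor lam^((k0 +
    1) s) accounts for rounding [x] down to such a level, and for [x] below lam^k0 the capacity is
    at most 1. *)
Lemma dyadic_tail_bound (X : Omega -> R) (t : nat -> R) (lam s D : R) (k0 : nat) :
  1 < lam -> 0 < s -> (forall j, 0 < t j) -> (forall j, lam `^ s * t j <= t j.+1) ->
  (forall j, t j * capr E [set w | lam ^+ (j + k0) <= `|X w|] <= D) ->
  exists C : R, forall x, 0 < x -> capr E [set w | x <= X w] <= C * x `^ (- s).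
Proof.
move=> lam1 s0 t0 tS HD.
have lam0 : 0 < lam by lra.
have D0 : 0 <= D by apply: le_trans (HD 0%N); rewrite mulr_ge0 ?capr_ge0// ltW.
have tj j : (lam `^ s) ^+ j * t 0%N <= t j.
  elim: j => [|j IH]; first by rewrite expr0 mul1r.
  by rewrite exprS -mulrA (le_trans _ (tS j))// ler_wpM2l ?powR_ge0.
pose C0 := (lam ^+ k0.+1) `^ s.
have C00 : 0 < C0 by rewrite powR_gt0// exprn_gt0.
exists (C0 * (1 + D / t 0%N)) => x x0.
have q0 : 0 <= D / t 0%N by rewrite divr_ge0// ltW.
rewrite powRN ler_pdivlMr ?powR_gt0//.
have lk : 0 < lam ^+ k0 by rewrite exprn_gt0.
have [xk|kx] := leP x (lam ^+ k0).
  apply: (@le_trans _ _ (1 * (C0 * 1))).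
    apply: ler_pM; rewrite ?capr_ge0 ?powR_ge0 ?capr_le1// mulr1.
    apply: ge0_ler_powR; rewrite ?nnegrE ?exprn_ge0 ?(ltW s0) ?(ltW lam0) ?(ltW x0)//.
    by rewrite (le_trans xk)// ler_eXn2l.
  by rewrite mul1r ler_wpM2l ?(ltW C00)// lerDl.
have y1 : 1 <= x / lam ^+ k0 by rewrite ler_pdivlMr// mul1r ltW.
have [j /andP[]] := expr_bracket lam1 y1.
rewrite ler_pdivlMr// ltr_pdivrMr// -!exprD => h1 h2.
have hx : x `^ s <= C0 * (lam `^ s) ^+ j.
  rewrite -powR_exprn ?(ltW lam0)// /C0 -powRM ?exprn_ge0 ?(ltW lam0)// -exprD.
  rewrite addSn addnC -addSn.
  by apply: ge0_ler_powR; rewrite ?nnegrE ?exprn_ge0 ?(ltW s0) ?(ltW lam0) ?(ltW x0) ?(ltW h2).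
have hc : capr E [set w | x <= X w] <= capr E [set w | lam ^+ (j + k0) <= `|X w|].
  by apply: le_capr => w /= xw; rewrite (le_trans h1)// (le_trans xw)// ler_norm.
set c := capr E _ in hc *; set c' := capr E _ in hc.
have c'0 : 0 <= c' by exact: capr_ge0.
apply: le_trans (ler_pM (capr_ge0 _ _) (powR_ge0 _ _) hc hx) _.
rewrite mulrCA ler_wpM2l ?(ltW C00)//.
apply: (@le_trans _ _ (D / t 0%N)); last by rewrite lerDr.
rewrite ler_pdivlMr// -mulrA mulrC (le_trans _ (HD j))// -/c'.
by rewrite ler_wpM2r.
Qed.

End dyadic_tails.

(** * The one-sided estimate *)

Section one_sided.
Context {R : realType} {d : measure_display} {Omega : measurableType d}.
Context (E : sublinear_space R Omega).

(** With T = kappa ln n, exp(3T) = n^(alpha s - 1) reduces the denominator n^(alpha s) to n. Each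
    factor is then at most exp(D3 (1 + a_i^q) / n), and the moment condition on the weights bounds
    the product uniformly in n. *)
Lemma truncation_capacity_bound (X : Omega -> R) (Xs : nat -> Omega -> R)
    (a : nat -> nat -> R) (alpha q s D Ca eps B : R) :
  rv E X -> (forall i, (1 <= i)%N -> rv E (Xs i)) ->
  (forall i, (1 <= i)%N -> identically_distributed E (Xs i) X) ->
  upper_END E Xs ->
  0 < alpha -> 0 < s -> s <= q -> 1 < alpha * s -> 0 <= D ->
  (forall z T, 0 <= z -> 0 <= T ->
    (sexp E (exp_trunc T z \o X) <= (1 + D * expR (3 * T) * z `^ s)%:E)%E) ->
  (forall n i, (1 <= i <= n)%N -> 0 <= a n i) ->
  (forall n, (1 <= n)%N -> \sum_(1 <= i < n.+1) a n i `^ q <= Ca * n%:R) ->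
  0 < eps -> 0 < B ->
  exists delta P : R, [/\ 0 < delta, 0 <= P & forall n, (1 <= n)%N ->
    capr E [set w | eps * n%:R `^ alpha < \sum_(1 <= i < n.+1) a n i * Xs i w] <=
    \sum_(1 <= i < n.+1)
      capr E [set w | 1/2 <= a n i / (delta * n%:R `^ alpha) * `|X w|] +
    P * n%:R `^ (- B)].
Proof.
move=> rX rXs ids [K [K1 HK]] alpha0 s0 sq as1 D0 HD a0 Ha eps0 B0.
have K0 : 0 <= K by lra.
pose kappa := (alpha * s - 1) / 3.
have kappa0 : 0 < kappa by rewrite /kappa; lra.
(* Chosen so that the exponent T eps n^alpha / b equals B ln n. *)
pose delta := kappa * eps / B.
have delta0 : 0 < delta by apply: divr_gt0 => //; exact: mulr_gt0.
pose D3 := D / delta `^ s.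
have D30 : 0 <= D3 by rewrite divr_ge0 ?powR_ge0.
exists delta, (K * expR (D3 * (1 + Ca))); split=> //; first by rewrite mulr_ge0 ?expR_ge0.
move=> n n1.
have nR : 0 < n%:R :> R by rewrite ltr0n.
have nR1 : 1 <= n%:R :> R by rewrite ler1n.
have n_neq0 : n%:R != 0 :> R by rewrite gt_eqF.
pose T := kappa * ln n%:R.
have T0 : 0 <= T by rewrite mulr_ge0 ?ln_ge0// ltW.
pose b := delta * n%:R `^ alpha.
have na0 : 0 < n%:R `^ alpha :> R by rewrite powR_gt0.
have b0 : 0 < b by rewrite mulr_gt0.
have z0 i : (1 <= i <= n)%N -> 0 <= a n i / b by move=> /a0 ai; rewrite divr_ge0// ltW.
have := @weighted_sum_capacity_le _ _ _ E X Xs K n (a n) _ T b (eps * n%:R `^ alpha)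
  rX rXs ids K0 HK n1 (a0 n) T0 b0 (fun i ii => HD _ _ (z0 i ii) T0).
move/le_trans; apply; rewrite lerD2l.
have -> : expR (- (T * (eps * n%:R `^ alpha) / b)) = n%:R `^ (- B) :> R.
  have -> : T * (eps * n%:R `^ alpha) / b = B * ln n%:R.
    by rewrite /T /b /delta; field; rewrite !gt_eqF.
  by rewrite /powR (negbTE n_neq0) mulNr.
rewrite mulrC ler_wpM2r ?powR_ge0// ler_wpM2l//.
have e3T : expR (3 * T) = n%:R `^ (alpha * s - 1).
  by rewrite /powR (negbTE n_neq0) /T /kappa; congr expR; lra.
have Mi i : (1 <= i <= n)%N -> 1 + D * expR (3 * T) * (a n i / b) `^ s <=
    expR (D3 * (1 + a n i `^ q) / n%:R).
  move=> ii; apply: le_trans (expR_ge1Dx _); rewrite lerD2l.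
  have ai := a0 _ _ ii.
  have asq : a n i `^ s <= 1 + a n i `^ q.
    have [a1|a1] := leP (a n i) 1.
      apply: (@le_trans _ _ 1); last by rewrite lerDl powR_ge0.
      have := @ge0_ler_powR _ s (ltW s0) (a n i) 1.
      by rewrite powR1 !nnegrE; apply.
    apply: (@le_trans _ _ (a n i `^ q)); last by rewrite lerDr.
    by apply: ler_powR => //; exact: ltW.
  have bs : b `^ s = delta `^ s * n%:R `^ (alpha * s).
    by rewrite powRM ?(ltW delta0) ?powR_ge0// powRrM.
  have aib : (a n i / b) `^ s = a n i `^ s / b `^ s.
    by rewrite powRM ?invr_ge0 ?(ltW b0)// -powR_inv1 ?(ltW b0)// powRAC powR_inv1 ?powR_ge0.
  rewrite e3T aib bs powRB ?n_neq0 ?implybT// powRr1 ?(ltW nR)//.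
  have p1 : n%:R `^ (alpha * s) != 0 :> R by rewrite gt_eqF// powR_gt0.
  have p2 : delta `^ s != 0 by rewrite gt_eqF// powR_gt0.
  have -> : D * (n%:R `^ (alpha * s) / n%:R) *
     (a n i `^ s / (delta `^ s * n%:R `^ (alpha * s))) = D3 / n%:R * a n i `^ s.
    by rewrite /D3; field; rewrite n_neq0 p1 p2.
  have -> : D3 * (1 + a n i `^ q) / n%:R = D3 / n%:R * (1 + a n i `^ q) by rewrite mulrAC.
  by rewrite ler_wpM2l// divr_ge0// ltW.
apply: (@le_trans _ _ (\prod_(1 <= i < n.+1) expR (D3 * (1 + a n i `^ q) / n%:R))).
  rewrite big_nat [leRHS]big_nat; apply: ler_prod => i; rewrite ltnS => ii.
  by rewrite Mi// andbT addr_ge0// !mulr_ge0 ?expR_ge0 ?powR_ge0.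
rewrite -expR_sum ler_expR -big_distrl -big_distrr /= -mulrA ler_wpM2l//.
rewrite ler_pdivrMr// big_split /= sumr_const_nat subn1 /= mulrDl mul1r.
by rewrite lerD ?Ha.
Qed.

(** Merges the two regimes: [s' = s] from the tail when [p <= 1], and [s' = p] from the centered
    moment when [p > 1]. *)
Lemma exp_moment (X : Omega -> R) (p s C : R) : rv E X -> 0 < p -> p < 2 -> s < p ->
  (1 < p -> (sexp E X <= 0)%E /\ (sexp E (fun w => (`|X w| `^ p)%R) < +oo)%E) ->
  (forall x, 0 < x -> capr E [set w | x <= X w] <= C * x `^ (- s)) ->
  exists s' D, [/\ s <= s', s' <= p, 0 <= D & forall z T, 0 <= z -> 0 <= T ->
    (sexp E (exp_trunc T z \o X) <= (1 + D * expR (3 * T) * z `^ s')%:E)%E].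
Proof.
move=> rX p0 p2 sp mom tail.
have [p1|p1] := leP p 1.
  have s1 : s < 1 by lra.
  have [D [D0 HD]] := exp_moment_tail rX s1 tail.
  by exists s, D; split=> //; exact: ltW.
have [EX EXp] := mom p1.
have rXp : rv E (fun w => `|X w| `^ p).
  apply: (@rv_comp _ _ _ E (fun x => `|x| `^ p)) => //.
  by apply: powR_norm_C_lLip; exact: ltW.
have fin : sexp E (fun w => (`|X w| `^ p)%R) \is a fin_num.
  by rewrite ge0_fin_numE//; apply: sexp_ge_cst => // w; exact: powR_ge0.
have le_fin : (sexp E (fun w => (`|X w| `^ p)%R) <=
   (fine (sexp E (fun w => (`|X w| `^ p)%R)))%:E)%E by rewrite fineK.
have [D [D0 HD]] := exp_moment_centered rX (ltW p1) (ltW p2) EX le_fin.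
by exists p, D; split=> //; exact: ltW.
Qed.

(** The dependence and mean conditions are one-sided, so that the reflected sequence can satisfy
    them as well. *)
Theorem one_sided_convergence (p alpha q : R) (X : Omega -> R) (Xs : nat -> Omega -> R)
    (l : R -> R) (a : nat -> nat -> R) :
  0 < p -> p < 2 -> 0 < alpha -> 1 < alpha * p ->
  rv E X -> (forall n, (1 <= n)%N -> rv E (Xs n)) ->
  (forall n, (1 <= n)%N -> identically_distributed E (Xs n) X) ->
  upper_END E Xs ->
  (1 < p -> (sexp E X <= 0)%E /\ (sexp E (fun w => (`|X w| `^ p)%R) < +oo)%E) ->
  slowly_varying l ->
  (forall n i, (1 <= i <= n)%N -> 0 <= a n i) ->
  p < q ->
  (exists C : R, 0 < C /\ forall n, (1 <= n)%N ->
     \sum_(1 <= i < n.+1) a n i `^ q <= C * n%:R) ->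
  (choquet E (fun w => (`|X w| `^ p * l (`|X w| `^ alpha^-1))%R) < +oo)%E ->
  forall eps : R, 0 < eps ->
     (\sum_(1 <= n <oo) ((n%:R `^ (alpha * p - 2) * l n%:R)%R%:E *
        capacity E [set w | (eps * n%:R `^ alpha <
                             \sum_(1 <= i < n.+1) a n i * Xs i w)%R])
      < +oo)%E.
Proof.
move=> p0 p2 alpha0 ap1 rX rXs ids upper mom sl a0 pq [Ca [Ca0 Ha]] fin eps eps0.
have l0 : forall x, 0 < x -> 0 < l x by case: sl.
have two1 : 1 < 2 :> R by lra.
pose lam : R := 2 `^ alpha; pose u : R := 2 `^ (alpha * p).
have lam1 : 1 < lam by exact: powR_gt1.
have lam0 : 0 < lam by lra.
have uE : u = lam `^ p by rewrite /u powRrM.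
have ulq : u < lam `^ q by rewrite uE; exact: ltr_powR_exp.
(* The midpoint of 1/alpha and p gives both alpha s > 1 and s < p. In particular lam^s > 2, so that
   [t] at least doubles. *)
pose s := (alpha^-1 + p) / 2.
have Vp : alpha^-1 < p by rewrite -[_^-1]mul1r ltr_pdivrMr// mulrC.
have Va : 0 < alpha^-1 by rewrite invr_gt0.
have s0 : 0 < s by rewrite /s; lra.
have sp : s < p by rewrite /s; lra.
have as1 : 1 < alpha * s by rewrite mulrC -ltr_pdivrMr// mul1r /s; lra.
have two_lams : 2 < lam `^ s.
  by rewrite /lam -powRrM -{1}[2](@powRr1 _ 2)//; exact: ltr_powR_exp.
(* A growth rate for [t] strictly between lam^p and lam^q; below, [rho * r < 1] with r =
   lam^(-q). *)
pose rho := (u + lam `^ q) / 2.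
have u_ab : lam `^ s < u < rho.
  by rewrite {1}uE ltr_powR_exp//= /rho; lra.
have rho_lt : rho < lam `^ q by rewrite /rho; lra.
have [M [k0 [M1 t0 tS HM]]] := dyadic_scaleP sl u_ab.
pose t := dyadic_scale l (alpha * p) k0.
have {}t0 : forall j, 0 < t j by exact: t0.
have rho0 : 0 < rho by have /andP[] := u_ab; lra.
have tS1 j : lam `^ s * t j <= t j.+1 by have /andP[] := tS j.
have tS2 j : t j.+1 <= rho * t j by have /andP[] := tS j.
have t2 j : 2 * t j <= t j.+1.
  by rewrite (le_trans _ (tS1 j))// ler_wpM2r ?(ltW (t0 j))// ltW.
have HM1 m z : 1 <= z <= 2 -> M^-1 * l (2 ^+ (m + k0)) <= l (z * 2 ^+ (m + k0)).
  by move=> /(HM m)/andP[].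
have HM2 m z : 1 <= z <= 2 -> l (z * 2 ^+ (m + k0)) <= M * l (2 ^+ (m + k0)).
  by move=> /(HM m)/andP[].
pose G m A := capr E [set w | lam ^+ (m + k0) <= A * `|X w|].
have [D1 HD1] := choquet_dyadic_sum p0 alpha0 ap1 l0 M1 t0 t2 HM1 fin.
have GE j : G j 1 = capr E [set w | lam ^+ (j + k0) <= `|X w|].
  by rewrite /G; congr capr; apply/seteqP; split => w /=; rewrite mul1r.
have tau0 j : 0 <= t j * capr E [set w | lam ^+ (j + k0) <= `|X w|].
  by rewrite mulr_ge0 ?capr_ge0// ltW.
have HD1' j : t j * capr E [set w | lam ^+ (j + k0) <= `|X w|] <= D1.
  by apply: le_trans (HD1 j.+1); rewrite big_ord_recr /= lerDr sumr_ge0//.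
have [C tail] := dyadic_tail_bound lam1 s0 t0 tS1 HD1'.
have [s' [D [ss' s'p D0 HD]]] := exp_moment rX p0 p2 sp mom tail.
have q0 : 0 < q by exact: lt_trans p0 pq.
have s'0 : 0 < s' by exact: lt_le_trans s0 ss'.
have s'q : s' <= q by exact: le_trans s'p (ltW pq).
have as'1 : 1 < alpha * s' by rewrite (lt_le_trans as1)// ler_pM2l.
(* This exponent makes n^(-B) at most [r ^+ m] on the block, and t_m r^m stays bounded by [t 0]. *)
pose B := alpha * q.
have B0 : 0 < B by rewrite mulr_gt0.
have [delta [P [delta0 P0 HP]]] := truncation_capacity_bound rX rXs ids upper
  alpha0 s'0 s'q as'1 D0 HD a0 Ha eps0 B0.
have lq0 : 0 < lam `^ q by rewrite powR_gt0.
pose r := (lam `^ q)^-1.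
have r0 : 0 < r by rewrite invr_gt0.
have rr1 : rho * r < 1 by rewrite ltr_pdivrMr// mul1r.
(* [S j] spreads the dyadic tails [G i 1], i <= j, with the factor r per block. *)
pose S := nat_rect (fun=> R) (G 0%N 1) (fun j x => r * x + G j.+1 1).
have SS j : S j.+1 = r * S j + G j.+1 1 by [].
have G0 m A : 0 <= G m A by exact: capr_ge0.
have S0 j : 0 <= S j.
  by elim: j => [|j IH]; [exact: G0|rewrite SS addr_ge0 ?G0// mulr_ge0// ltW].
have Gmono m A A' : 0 <= A -> A <= A' -> G m A <= G m A'.
  by move=> A0 AA'; apply: le_capr => w /= /le_trans; apply; rewrite ler_wpM2r.
have GS m A : G m.+1 A = G m (A / lam).
  rewrite /G; congr capr; apply/seteqP; split => w /=;
  by rewrite addSn exprSr mulrAC -ler_pdivlMr.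
have GB := scaled_tail_bound lam1 q0 G0 Gmono GS erefl SS.
have conv N : \sum_(j < N) t j * S j <= D1 / (1 - rho * r).
  rewrite ler_pdivlMr ?subr_gt0// mulrC.
  have := @convolution_weighted_sum _ t (fun j => G j 1) S rho r S0 (ltW rho0) (ltW r0)
    (fun j => ltW (t0 j)) erefl SS tS2 N.
  move/le_trans; apply.
  by apply: le_trans (HD1 N); apply: ler_sum => j _; rewrite GE.
have trho m : t m * r ^+ m <= t 0%N.
  elim: m => [|m IH]; first by rewrite expr0 mulr1.
  apply: le_trans IH; rewrite exprS mulrA ler_wpM2r ?exprn_ge0 ?(ltW r0)//.
  apply: le_trans (ler_wpM2r (ltW r0) (tS2 m)) _.
  by rewrite mulrAC ger_pMl// ltW.
have lq2 : 2 < lam `^ q by rewrite (lt_trans two_lams)// ltr_powR_exp// (lt_trans sp).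
pose cA := (2 / delta) `^ q.
have cA0 : 0 <= cA by exact: powR_ge0.
(* Since lam^q > 2, the bound Ca n on a single a_i^q is eventually absorbed. This secures the side
   condition A <= lam^m of [GB] for A = 2 a_i / delta. *)
have [m1 Hm1] : exists m1, forall m, (m1 <= m)%N ->
    cA * Ca * 2 ^+ (m + k0).+1 <= (lam `^ q) ^+ m.
  pose c := cA * Ca * 2 ^+ k0.+1.
  have h1 : 1 < lam `^ q / 2 by rewrite ltr_pdivlMr// mul1r.
  have y1 : 1 <= 1 + `|c| by rewrite lerDl.
  have [j /andP[_ hj]] := expr_bracket h1 y1.
  exists j.+1 => m jm.
  have -> : cA * Ca * 2 ^+ (m + k0).+1 = c * 2 ^+ m.
    by rewrite /c -[RHS]mulrA -exprD addSn addnC.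
  rewrite -ler_pdivlMr ?exprn_gt0// -expr_div_n.
  apply: le_trans (_ : (lam `^ q / 2) ^+ j.+1 <= _); last by rewrite ler_eXn2l.
  by rewrite (le_trans _ (ltW hj))// (le_trans (ler_norm c))// lerDr.
pose C4 := 1 + lam `^ q * cA * Ca.
have C40 : 0 <= C4 by rewrite addr_ge0// !mulr_ge0 ?(ltW lq0) ?(ltW Ca0).
pose e m := u * M * (2 * C4 * (t m * S m) + P * t 0%N * (1 / 2) ^+ m).
have u0 : 0 < u by rewrite powR_gt0.
have uM0 : 0 <= u * M by rewrite mulr_ge0 ?(ltW u0)// (le_trans ler01).
have e0 m : 0 <= e m.
  have h1 : 0 <= t m * S m by rewrite mulr_ge0 ?(ltW (t0 m)).
  have h2 : 0 <= t 0%N * (1 / 2) ^+ m by rewrite mulr_ge0 ?exprn_ge0 ?(ltW (t0 _)).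
  have h3 : 0 <= 2 * C4 by rewrite mulr_ge0.
  rewrite /e -[P * _ * _]mulrA; apply: mulr_ge0 => //.
  by apply: addr_ge0; apply: mulr_ge0.
rewrite (eq_eseriesr (g := fun n => (n%:R `^ (alpha * p - 2) * l n%:R *
  capr E [set w | (eps * n%:R `^ alpha < \sum_(1 <= i < n.+1) a n i * Xs i w)%R])%:E)); last first.
  by move=> n _; rewrite caprE.
apply: (@dyadic_blocks_summable _ _ (fun m => e (m - k0)%N) (m1 + k0)
   (u * M * (2 * C4 * (D1 / (1 - rho * r)) + P * t 0%N * 2))).
- by move=> n n1; rewrite !mulr_ge0 ?powR_ge0 ?capr_ge0// ltW// l0// ltr0n.
- move=> m' n mm' nm.
  have mE : m' = ((m' - k0) + k0)%N by rewrite subnK// (leq_trans (leq_addl m1 k0)).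
  have mm : (m1 <= m' - k0)%N by rewrite leq_subRL ?(leq_trans (leq_addl m1 k0))// addnC.
  move: (m' - k0)%N mE mm => m -> mm {mm'} in nm *.
  set Z : R := 2 ^+ (m + k0).
  have Z1 : 1 <= Z by rewrite exprn_ege1// ltW.
  have Z0 : 0 < Z by exact: lt_le_trans ltr01 Z1.
  have [Zn nZ] : Z <= n%:R /\ n%:R <= 2 * Z.
    move: nm => /andP[h1 h2]; rewrite /Z -exprS -!natrX !ler_nat; split=> //; exact: ltnW.
  have n0 : 0 < n%:R :> R by exact: lt_le_trans Z0 Zn.
  have n1 : (1 <= n)%N by rewrite -(ltr0n R).
  have powZ b : Z `^ b = (2 `^ b) ^+ (m + k0) by rewrite powR_exprn.
  (* On the block n is between Z and 2Z: n^(alpha p) costs a factor u, l(n) a factor M, and n^(-2)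
     is at most Z^(-2). *)
  have weight : n%:R `^ (alpha * p - 2) * l n%:R <= u * M * t m / (Z * Z).
    have h1 : n%:R `^ (alpha * p - 2) <= u * u ^+ (m + k0) / (Z * Z).
      rewrite powRB ?(gt_eqF n0) ?implybT// powR_mulrn ?(ltW n0)// expr2.
      apply: ler_pM; rewrite ?invr_ge0 ?mulr_ge0 ?powR_ge0 ?(ltW n0)//; last first.
        by rewrite lef_pV2 ?posrE ?mulr_gt0// ler_pM ?(ltW Z0).
      rewrite -powZ -powRM ?(ltW Z0)//; apply: ge0_ler_powR;
        rewrite ?nnegrE ?mulr_ge0 ?(ltW n0) ?(ltW Z0) ?(ltW alpha0) ?(ltW p0)//.
    have h2 : l n%:R <= M * l Z.
      have h : 1 <= n%:R / Z <= 2 by rewrite ler_pdivlMr// mul1r Zn ler_pdivrMr.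
      by have := HM2 m _ h; rewrite -/Z divfK// gt_eqF.
    have := ler_pM (powR_ge0 _ _) (ltW (l0 _ n0)) h1 h2.
    move/le_trans; apply; rewrite /t /dyadic_scale -/u -/Z.
    by rewrite [leLHS](_ : _ = u * M * (u ^+ (m + k0) * l Z) / (Z * Z))//; ring.
  have nB : n%:R `^ (- B) <= r ^+ m.
    apply: (@le_trans _ _ (r ^+ (m + k0))); last first.
      rewrite exprD ler_piMr ?exprn_ge0 ?(ltW r0)// exprn_ile1 ?(ltW r0)//.
      by rewrite invf_le1// ltW// (lt_trans two1).
    rewrite powRN /r /lam -powRrM -/B exprVn -powZ.
    rewrite lef_pV2 ?posrE ?powR_gt0//.
    by apply: ge0_ler_powR; rewrite ?nnegrE ?(ltW Z0) ?(ltW n0) ?(ltW B0).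
  have caps : \sum_(1 <= i < n.+1)
      capr E [set w | 1/2 <= a n i / (delta * n%:R `^ alpha) * `|X w|]
      <= 2 * Z * C4 * S m.
    apply: (@le_trans _ _ (\sum_(1 <= i < n.+1)
        (1 + lam `^ q * (cA * a n i `^ q)) * S m)).
      rewrite big_nat [leRHS]big_nat; apply: ler_sum => i; rewrite ltnS => ii.
      have ai := a0 _ _ ii.
      have dV0 : 0 <= 2 / delta by rewrite divr_ge0 ?(ltW delta0).
      have A0 : 0 <= 2 / delta * a n i by rewrite mulr_ge0.
      have Aq : (2 / delta * a n i) `^ q = cA * a n i `^ q by rewrite powRM.
      have Am : 2 / delta * a n i <= lam ^+ m.
        rewrite leNgt; apply/negP => /(gt0_ltr_powR q0).
        rewrite !nnegrE A0 exprn_ge0 ?(ltW lam0)// => /(_ isT isT).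
        apply/negP; rewrite -leNgt Aq powR_exprn ?(ltW lam0)//.
        apply: le_trans (Hm1 m mm); rewrite -mulrA ler_wpM2l//.
        apply: (@le_trans _ _ (\sum_(1 <= i < n.+1) a n i `^ q)).
          rewrite (bigD1_seq i) ?iota_uniq ?mem_index_iota ?ltnS//= lerDl.
          by apply: sumr_ge0 => j _; exact: powR_ge0.
        apply: le_trans (Ha n n1) _; rewrite ler_wpM2l ?(ltW Ca0)//.
        by rewrite exprS.
      rewrite -Aq; apply: le_trans (GB m _ A0 Am); apply: le_capr => w /=.
      have na0 : 0 < n%:R `^ alpha :> R by rewrite powR_gt0.
      rewrite mulrAC ler_pdivlMr ?mulr_gt0// => h.
      have h' : n%:R `^ alpha <= 2 / delta * a n i * `|X w|.
        have -> : 2 / delta * a n i * `|X w| = 2 * (a n i * `|X w|) / delta by ring.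
        rewrite ler_pdivlMr// [_ * delta]mulrC.
        by move: h; clear; lra.
      apply: le_trans h'; rewrite /lam -powZ.
      by apply: ge0_ler_powR; rewrite ?nnegrE ?(ltW Z0) ?(ltW n0) ?(ltW alpha0).
    rewrite -big_distrl /= ler_wpM2r//.
    rewrite big_split /= sumr_const_nat subn1 /= -!big_distrr /=.
    apply: (@le_trans _ _ (n%:R * C4)); last by rewrite ler_wpM2r.
    have := Ha n n1 => /(ler_wpM2l cA0)/(ler_wpM2l (ltW lq0)).
    by rewrite /C4; clear; lra.
  have cap_le := le_trans (HP n n1) (lerD caps (ler_wpM2l P0 nB)).
  have w0 : 0 <= n%:R `^ (alpha * p - 2) * l n%:R.
    by rewrite mulr_ge0 ?powR_ge0// ltW// l0.
  apply: le_trans (ler_pM w0 (capr_ge0 _ _) weight cap_le) _.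
  (* One factor 1/Z cancels against the number of summands in [caps]. The other is the 1/2^m'
     required per term of a block. *)
  have -> : u * M * t m / (Z * Z) * (2 * Z * C4 * S m + P * r ^+ m) =
      u * M * (2 * C4 * (t m * S m) + P * (t m * r ^+ m) / Z) / Z.
    by field; rewrite gt_eqF.
  rewrite /e ler_wpM2r ?invr_ge0 ?(ltW Z0)// ler_wpM2l//.
  rewrite lerD2l; apply: ler_pM.
  - apply: mulr_ge0 => //; apply: mulr_ge0; first exact: ltW.
    by apply: exprn_ge0; exact: ltW.
  - by rewrite invr_ge0 ltW.
  - exact: ler_wpM2l (trho m).
  by rewrite div1r exprVn lef_pV2 ?posrE ?exprn_gt0// ler_eXn2l// leq_addr.
- move=> N; rewrite big_addn.
  apply: (@le_trans _ _ (\sum_(0 <= i < N - k0) e i)).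
    rewrite (eq_bigr e); last by move=> i _; rewrite addnK.
    have [h|h] := leqP m1 (N - k0); last by rewrite big_geq ?sumr_ge0// ltnW.
    by rewrite [leRHS](@big_cat_nat _ _ _ m1)//= lerDr sumr_ge0.
  rewrite /e -big_distrr /= ler_wpM2l//.
  rewrite big_split /= -!big_distrr /= big_mkord lerD//.
    by rewrite ler_wpM2l ?mulr_ge0.
  apply: ler_wpM2l; first by apply: mulr_ge0 => //; exact: ltW.
  suff -> : \sum_(0 <= i < N - k0) (1 / 2) ^+ i = 2 - 2 * (1 / 2) ^+ (N - k0) :> R.
    by rewrite gerBl mulr_ge0// exprn_ge0.
  elim: (N - k0)%N => [|n IH]; first by rewrite big_geq// expr0; lra.
  by rewrite big_nat_recr//= IH exprS; lra.
Qed.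

End one_sided.

(** * Reflection and the two-sided estimate *)

Section reflection.
Context {R : realType} {d : measure_display} {Omega : measurableType d}.
Context (E : sublinear_space R Omega).

Lemma rvN (X : Omega -> R) : rv E X -> rv E (fun w => - X w).
Proof.
move=> rX; rewrite (_ : (fun w => _) = (fun w => -1 * X w)); first exact: rvZ.
by apply/funext => w; rewrite mulN1r.
Qed.

Lemma identically_distributedN (X Y : Omega -> R) : identically_distributed E X Y ->
  identically_distributed E (fun w => - X w) (fun w => - Y w).
Proof. by move=> XY phi /C_lLip_opp; exact: XY. Qed.

(** Precomposing with negation turns nondecreasing test functions into nonincreasing ones, with the
    same constant. *)
Lemma lower_END_upperN (Xs : nat -> Omega -> R) :
  lower_END E Xs -> upper_END E (fun n w => - Xs n w).
Proof.
move=> [K [K1 HK]]; exists K; split=> // f hf n n1.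
apply: (HK (fun i x => f i (- x))) => // i i1; have [fb f0 fm] := hf i i1; split=> //.
  exact: C_bLip_opp.
by move=> x y xy; apply: fm; rewrite lerN2.
Qed.

End reflection.

Unset Implicit Arguments.

Theorem theorem2p4 (R : realType) (d : measure_display)
    (Omega : measurableType d) (E : sublinear_space R Omega)
    (p alpha q : R) (X : Omega -> R) (Xs : nat -> Omega -> R)
    (l : R -> R) (a : nat -> nat -> R) :
  0 < p -> p < 2 -> 0 < alpha -> 1 < alpha * p ->
  rv E X ->
  (forall n, (1 <= n)%N -> rv E (Xs n)) ->
  (forall n, (1 <= n)%N -> identically_distributed E (Xs n) X) ->
  END E Xs ->
  (1 < p -> sexp E X = 0%E /\ (sexp E (fun w => (`|X w| `^ p)%R) < +oo)%E) ->
  slowly_varying l ->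
  (forall n i, (1 <= i <= n)%N -> 0 <= a n i) ->
  p < q ->
  (exists C : R, 0 < C /\ forall n, (1 <= n)%N ->
     \sum_(1 <= i < n.+1) a n i `^ q <= C * n%:R) ->
  (choquet E (fun w => (`|X w| `^ p * l (`|X w| `^ alpha^-1))%R) < +oo)%E ->
  (forall eps : R, 0 < eps ->
     (\sum_(1 <= n <oo) ((n%:R `^ (alpha * p - 2) * l n%:R)%R%:E *
        capacity E [set w | (eps * n%:R `^ alpha <
                             \sum_(1 <= i < n.+1) a n i * Xs i w)%R])
      < +oo)%E)
  /\
  ((1 < p -> conj_sexp E X = 0%E) ->
   forall eps : R, 0 < eps ->
     (\sum_(1 <= n <oo) ((n%:R `^ (alpha * p - 2) * l n%:R)%R%:E *
        capacity E [set w | (eps * n%:R `^ alpha <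
                             `|\sum_(1 <= i < n.+1) a n i * Xs i w|)%R])
      < +oo)%E).
Proof.
move=> p0 p2 alpha0 ap1 rX rXs ids [upper lower] mom sl a0 pq Ha fin.
have mom0 : 1 < p -> (sexp E X <= 0)%E /\ (sexp E (fun w => (`|X w| `^ p)%R) < +oo)%E.
  by move=> /mom[-> ->].
have part1 := one_sided_convergence p0 p2 alpha0 ap1 rX rXs ids upper
  mom0 sl a0 pq Ha fin.
split=> [//|conj0 eps eps0].
have finN : (choquet E (fun w => (`|- X w| `^ p * l (`|- X w| `^ alpha^-1))%R) < +oo)%E.
  by under eq_fun do rewrite normrN.
have momN : 1 < p -> (sexp E (fun w => (- X w)%R) <= 0)%E /\
    (sexp E (fun w => (`|- X w| `^ p)%R) < +oo)%E.
  move=> p1; split; last by under eq_fun do rewrite normrN; case: (mom p1).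
  (* The vanishing conjugate expectation says exactly that -X has expectation 0. *)
  by have /eqP := conj0 p1; rewrite /conj_sexp oppe_eq0 => /eqP ->.
have part2 := one_sided_convergence p0 p2 alpha0 ap1 (rvN rX) (fun n n1 => rvN (rXs n n1))
  (fun n n1 => identically_distributedN (ids n n1)) (lower_END_upperN lower)
  momN sl a0 pq Ha finN eps0.
have w0 n : (1 <= n)%N -> 0 <= n%:R `^ (alpha * p - 2) * l n%:R.
  by move=> n1; case: sl => l0 _ _; rewrite mulr_ge0 ?powR_ge0// ltW// l0// ltr0n.
have term0 n (A : set Omega) : (1 <= n)%N ->
    (0 <= (n%:R `^ (alpha * p - 2) * l n%:R)%:E * capacity E A)%E.
  by move=> n1; rewrite mule_ge0 ?capacity_ge0// lee_fin w0.
apply: le_lt_trans (lte_add_pinfty (part1 _ eps0) part2).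
rewrite -nneseriesD; last 2 first.
- by move=> n n1 _; exact: term0.
- by move=> n n1 _; exact: term0.
rewrite eseries_cond [leRHS]eseries_cond.
apply: lee_nneseries => n; first by move=> _ /andP[_ n1]; exact: term0.
move=> /= n1; rewrite !caprE -!EFinM -EFinD lee_fin -mulrDr ler_wpM2l ?w0//.
(* The two-sided event is contained in the union of the one-sided events for the sum and for its
   negative. *)
apply: le_trans (caprU _ _ _); apply: le_capr => w /=.
have -> : \sum_(1 <= i < n.+1) a n i * - Xs i w = - \sum_(1 <= i < n.+1) a n i * Xs i w.
  by rewrite -sumrN; apply: eq_bigr => i _; rewrite mulrN.
by set x := \sum_(_ <= _ < _) _; have [x0|x0] := leP 0 x;
  [rewrite ger0_norm//; left|rewrite ltr0_norm//; right].
Qed.
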